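(* Let $\varepsilon > 0$, and let $R$ be one of the following rings: $R = \mathbb{Z}$; $R = \mathbb{Z}/a\mathbb{Z}$ for an integer $a > 0$; or $R = \mathbb{Z}_p$ for a prime $p$. For each positive integer $n$, let $C_n$ be a deterministic $n\times n$ alternating matrix over $R$, and let $h$ be a positive integer dividing all entries of $C_n$ in $R$ for every $n$. Suppose that the cokernel of $C_n/h$ can be generated by $g_n$ elements over $R$. Let $X_n$ be a random $C_n$-symmetric $n\times n$ matrix over $R$ whose entries on and above the diagonal are independent and $\varepsilon$-balanced. Assume that $$\lim_{n\to\infty} (n - g_n) = \infty.$$ Then for any finite abelian group $G$ (if $R = \mathbb{Z}$), respectively any finite abelian group $G$ of exponent dividing $a$ (if $R = \mathbb{Z}/a\mathbb{Z}$), respectively any finite abelian $p$-group $G$ (if $R = \mathbb{Z}_p$), we have $$\lim_{n\to\infty} \mathbb{E}[\#\operatorname{Sur}(\operatorname{coker}(X_n), G)] = |\wedge^2 (G[h])|.$$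
   Context: An $n\times n$ matrix $C$ over a commutative ring $R$ is alternating if $C^{\intercal} = -C$ and all its diagonal entries are $0$. For an alternating $C$, an $n\times n$ matrix $X$ over $R$ is called $C$-symmetric if $X - X^{\intercal} = C$. A random variable $N$ valued in a ring $R$ is $\varepsilon$-balanced if for every maximal ideal $\mathfrak{p}$ of $R$ and every residue class $r \in R/\mathfrak{p}$ one has $\mathbb{P}[N \equiv r \pmod{\mathfrak{p}}] \leq 1-\varepsilon$. For an $n\times n$ matrix $M$ over a ring $S$, $\operatorname{coker}(M) = S^n/M(S^n)$. $\operatorname{Sur}(A,G)$ is the set of surjective group homomorphisms $A \to G$. $G[h]$ is the subgroup of elements of $G$ of order dividing $h$, and $\wedge^2$ is the exterior square over $\mathbb{Z}$. Write $R[h] = \{r \in R : hr = 0\}$. The matrix $C_n/h$ is the unique matrix over $R/R[h]$ sent to $C_n$ by the entrywise isomorphism $R/R[h] \to hR$, $x \mapsto hx$ (so when $R = \mathbb{Z}$ or $\mathbb{Z}_p$, it is the ordinary quotient, a matrix over $R$). *)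

(* Defs.v *)
From HB Require Import structures.
From mathcomp Require Import all_boot all_order all_algebra all_fingroup all_solvable.
From mathcomp Require Import ring_quotient generic_quotient.
From mathcomp Require Import all_classical all_reals all_analysis.

Set Implicit Arguments.
Unset Strict Implicit.
Unset Printing Implicit Defensive.

Import Order.TTheory GRing.Theory Num.Theory.
Import numFieldNormedType.Exports.

Local Open Scope classical_set_scope.
Local Open Scope ring_scope.
Local Open Scope quotient_scope.

Notation "{ 'quot' I }" := (Quotient.quot I) (format "{ 'quot'  I }") : type_scope.

Section Cokernel.
Variables (S : comPzRingType) (n : nat) (M : 'M[S]_n).

Definition mximage_pred : 'cV[S]_n -> bool :=
  fun v => `[< exists w : 'cV[S]_n, v = M *m w >].

Fact mximage_zmod : zmod_closed mximage_pred.
Proof.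
split=> [|x y]; first by apply/asboolP; exists 0; rewrite mulmx0.
by move=> /asboolP[u ->] /asboolP[v ->]; apply/asboolP; exists (u - v);
  rewrite mulmxBr.
Qed.
HB.instance Definition _ := GRing.isZmodClosed.Build 'cV[S]_n mximage_pred
  mximage_zmod.
Definition mximage : zmodClosed 'cV[S]_n :=
  (mximage_pred : {pred _}).

Fact mximageZ a v : v \in mximage -> a *: v \in mximage.
Proof.
by move=> /asboolP[w ->]; apply/asboolP; exists (a *: w); rewrite scalemxAr.
Qed.

Definition coker : Type := {quot mximage}.
HB.instance Definition _ := GRing.Zmodule.on coker.

Definition coker_proj (v : 'cV[S]_n) : coker := \pi_({quot mximage}) v.

Definition coker_scale (a : S) (x : coker) : coker :=
  coker_proj (a *: repr (x : {quot mximage})).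

Fact coker_projD : {morph coker_proj : u v / u + v}.
Proof. exact: (raddfD \pi_({quot mximage})). Qed.

Fact coker_projW (x : coker) : exists v, x = coker_proj v.
Proof. by exists (repr (x : {quot mximage})); rewrite /coker_proj reprK. Qed.

Fact coker_projZ a v : coker_proj (a *: v) = coker_scale a (coker_proj v).
Proof.
apply/eqP; rewrite eqmodE /= Quotient.equivE -scalerBr mximageZ //.
by rewrite Quotient.idealrBE /coker_proj reprK.
Qed.

Fact coker_scaleA a b x :
  coker_scale a (coker_scale b x) = coker_scale (a * b) x.
Proof. by have [v ->] := coker_projW x; rewrite -(coker_projZ b v) -!coker_projZ scalerA. Qed.

Fact coker_scale1 : left_id 1 coker_scale.
Proof. by move=> x; have [v ->] := coker_projW x; rewrite -coker_projZ scale1r. Qed.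

Fact coker_scaleDr : right_distributive coker_scale +%R.
Proof.
move=> a x y; have [u ->] := coker_projW x; have [v ->] := coker_projW y.
by rewrite -coker_projD -!coker_projZ scalerDr coker_projD.
Qed.

Fact coker_scaleDl x : {morph coker_scale^~ x : a b / a + b}.
Proof.
by move=> a b; have [v ->] := coker_projW x; rewrite -!coker_projZ scalerDl coker_projD.
Qed.

HB.instance Definition _ := GRing.Zmodule_isLmodule.Build S coker
  coker_scaleA coker_scale1 coker_scaleDr coker_scaleDl.

End Cokernel.

(* Unlike [idealr] of [ring_quotient], an ideal may be the whole ring: R / R[h]
   and Z / 1Z can be the zero ring. *)
HB.mixin Record isAbsorbing (R : comPzRingType) (S : R -> bool) := {
  absorbing_subproof : forall a, {in S, forall u, a * u \in S}
}.

#[short(type="ideal")]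
HB.structure Definition Ideal (R : comPzRingType) :=
  {S of GRing.ZmodClosed R S & isAbsorbing R S}.

Lemma idealMl (R : comPzRingType) (I : ideal R) a u : u \in I -> a * u \in I.
Proof. exact: absorbing_subproof. Qed.

Section RingQuotient.
Variables (R : comPzRingType) (I : ideal R).

Definition quot_ring : Type := {quot I}.
HB.instance Definition _ := GRing.Zmodule.on quot_ring.

Definition quot_proj (x : R) : quot_ring := \pi_({quot I}) x.

Fact quot_projD : {morph quot_proj : x y / x + y}.
Proof. exact: (raddfD \pi_({quot I})). Qed.

Lemma quot_proj_eq x y : (quot_proj x = quot_proj y) <-> x - y \in I.
Proof.
by rewrite Quotient.idealrBE; split=> [/eqP //|/eqP].
Qed.

Lemma quot_projW (x : quot_ring) : exists r, x = quot_proj r.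
Proof. by exists (repr (x : {quot I})); rewrite /quot_proj reprK. Qed.

Definition quot_mul (x y : quot_ring) : quot_ring :=
  quot_proj (repr (x : {quot I}) * repr (y : {quot I})).

Lemma quot_projM x y : quot_proj (x * y) = quot_mul (quot_proj x) (quot_proj y).
Proof.
apply/quot_proj_eq; set x' := repr _; set y' := repr _.
have -> : x * y - x' * y' = y * (x - x') + x' * (y - y').
  by rewrite !mulrBr addrA [y * x]mulrC [y * x']mulrC subrK.
by rewrite rpredD // idealMl //; apply/quot_proj_eq; rewrite /quot_proj reprK.
Qed.

Fact quot_mulA : associative quot_mul.
Proof.
move=> x y z; have [a ->] := quot_projW x; have [b ->] := quot_projW y.
have [c ->] := quot_projW z.
by rewrite -(quot_projM b c) -(quot_projM a b) -!quot_projM mulrA.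
Qed.

Fact quot_mulC : commutative quot_mul.
Proof.
move=> x y; have [a ->] := quot_projW x; have [b ->] := quot_projW y.
by rewrite -!quot_projM mulrC.
Qed.

Fact quot_mul1 : left_id (quot_proj 1) quot_mul.
Proof. by move=> x; have [a ->] := quot_projW x; rewrite -quot_projM mul1r. Qed.

Fact quot_mulDl : left_distributive quot_mul +%R.
Proof.
move=> x y z; have [a ->] := quot_projW x; have [b ->] := quot_projW y.
have [c ->] := quot_projW z.
by rewrite -quot_projD -!quot_projM mulrDl quot_projD.
Qed.

HB.instance Definition _ := GRing.Zmodule_isComPzRing.Build quot_ring
  quot_mulA quot_mulC quot_mul1 quot_mulDl.

End RingQuotient.

Definition maximal_ideal (R : comPzRingType) (I : ideal R) : Prop :=
  (exists x, x \notin I) /\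
  forall J : ideal R, {subset I <= J} -> J =i I \/ forall x, x \in J.

Fact dvdz_absorbing (a x : int) : {in dvdz a, forall u, x * u \in dvdz a}.
Proof. by move=> u; exact: dvdz_mull. Qed.
HB.instance Definition _ (a : int) := isAbsorbing.Build int (dvdz a)
  (@dvdz_absorbing a).

Definition zmultiples (a : nat) : ideal int := (dvdz a : {pred _}).

Definition Zmod (a : nat) : comPzRingType := quot_ring (zmultiples a).

(* p-adic integers as the inverse limit of the Z / p^k: the k-th term is the
   canonical representative of the residue class mod p^k. *)
Definition padic_seq (p : nat) : pred (nat -> int) :=
  fun x => `[< forall k, x k = (x k.+1 %% (p ^ k)%N)%Z >].

Definition padic_int (p : nat) : Type := {x : nat -> int | padic_seq p x}.
HB.instance Definition _ p := Choice.on (padic_int p).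

Section PadicRing.
Variable p : nat.
Implicit Types x y z : padic_int p.

Definition residue x (k : nat) : int := sval x k.

Lemma residue_mod x k : (residue x k %% (p ^ k)%N)%Z = residue x k.
Proof. by case: x => u /= pu; have /asboolP/(_ k) -> := pu; rewrite modz_mod. Qed.

Lemma residueS x k : (residue x k.+1 %% (p ^ k)%N)%Z = residue x k.
Proof. by case: x => u pu; have /asboolP/(_ k) := pu. Qed.

Lemma padicP x y : (forall k, residue x k = residue y k) -> x = y.
Proof. by move=> xy; apply/val_inj/funext. Qed.

Fact padic_subproof (u : nat -> int) :
  (forall k, (u k = u k.+1 %[mod (p ^ k)%N])%Z) ->
  padic_seq p (fun k => (u k %% (p ^ k)%N)%Z).
Proof.
move=> uP; apply/asboolP => k; rewrite uP; apply/eqP; rewrite eqz_mod_dvd.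
rewrite [X in X - _](divz_eq _ (p ^ k.+1)%N) addrK expnSr PoszM mulrCA.
exact: dvdz_mulr.
Qed.

Definition mk_padic u (uP : forall k, (u k = u k.+1 %[mod (p ^ k)%N])%Z) :
  padic_int p :=
  exist (padic_seq p) _ (padic_subproof uP).

Fact padic_cst_subproof (c : int) k : (c = c %[mod (p ^ k)%N])%Z.
Proof. by []. Qed.

Fact padic_opp_subproof x k :
  (- residue x k = - residue x k.+1 %[mod (p ^ k)%N])%Z.
Proof. by rewrite -[residue x k]residueS modzNm. Qed.

Fact padic_add_subproof x y k : (residue x k + residue y k =
  residue x k.+1 + residue y k.+1 %[mod (p ^ k)%N])%Z.
Proof. by rewrite -[residue x k]residueS -[residue y k]residueS modzDm. Qed.

Fact padic_mul_subproof x y k : (residue x k * residue y k =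
  residue x k.+1 * residue y k.+1 %[mod (p ^ k)%N])%Z.
Proof. by rewrite -[residue x k]residueS -[residue y k]residueS modzMm. Qed.

Definition padic_cst c := mk_padic (padic_cst_subproof c).
Definition padic_opp x := mk_padic (padic_opp_subproof x).
Definition padic_add x y := mk_padic (padic_add_subproof x y).
Definition padic_mul x y := mk_padic (padic_mul_subproof x y).

Fact padic_addA : associative padic_add.
Proof.
by move=> x y z; apply: padicP => k; rewrite /residue /= modzDml modzDmr addrA.
Qed.

Fact padic_addC : commutative padic_add.
Proof. by move=> x y; apply: padicP => k; rewrite /residue /= addrC. Qed.

Fact padic_add0 : left_id (padic_cst 0) padic_add.
Proof.
by move=> x; apply: padicP => k; rewrite /residue /= modzDml add0r residue_mod.
Qed.

Fact padic_addN : left_inverse (padic_cst 0) padic_opp padic_add.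
Proof. by move=> x; apply: padicP => k; rewrite /residue /= modzDml addNr. Qed.

HB.instance Definition _ := GRing.isZmodule.Build (padic_int p)
  padic_addA padic_addC padic_add0 padic_addN.

Fact padic_mulA : associative padic_mul.
Proof.
by move=> x y z; apply: padicP => k; rewrite /residue /= modzMml modzMmr mulrA.
Qed.

Fact padic_mulC : commutative padic_mul.
Proof. by move=> x y; apply: padicP => k; rewrite /residue /= mulrC. Qed.

Fact padic_mul1 : left_id (padic_cst 1) padic_mul.
Proof.
by move=> x; apply: padicP => k; rewrite /residue /= modzMml mul1r residue_mod.
Qed.

Fact padic_mulDl : left_distributive padic_mul +%R.
Proof.
by move=> x y z; apply: padicP => k; rewrite /residue /= modzMml modzDm mulrDl.
Qed.

HB.instance Definition _ := GRing.Zmodule_isComPzRing.Build (padic_int p)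
  padic_mulA padic_mulC padic_mul1 padic_mulDl.

End PadicRing.

Inductive base_ring : Type :=
| BaseZ
| BaseZmod (a : nat) of (0 < a)%N
| BaseZp (p : nat) of prime p.

Definition ring_of (R : base_ring) : comPzRingType :=
  match R with
  | BaseZ => int
  | BaseZmod a _ => Zmod a
  | BaseZp p _ => padic_int p
  end.
Coercion ring_of : base_ring >-> GRing.ComPzRing.type.

(* The discrete topology on Z and Z / aZ, the p-adic topology on Z_p. *)
Definition ring_open (R : base_ring) : set (set R) :=
  match R with
  | BaseZ | BaseZmod _ _ => setT
  | BaseZp p _ => [set U : set (padic_int p) | forall x, U x ->
      exists k, forall y, residue y k = residue x k -> U y]
  end.

Definition ring_borel (R : base_ring) : set (set R) := <<s @ring_open R >>.
Arguments ring_borel : clear implicits.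

Definition admissible (R : base_ring) (G : finZmodType) : Prop :=
  match R with
  | BaseZ => True
  | BaseZmod a _ => (exponent [set: G]%SET %| a)%N
  | BaseZp p _ => pgroup p [set: G]%SET
  end.

Section DivideByInteger.
Variables (R : comPzRingType) (h : nat).

(* R[h] *)
Definition ann_pred : R -> bool := fun r => h%:R * r == 0.

Fact ann_zmod : zmod_closed ann_pred.
Proof.
split=> [|x y]; first by rewrite /in_mem /= /ann_pred mulr0.
by rewrite /in_mem /= /ann_pred => /eqP hx /eqP hy; rewrite mulrBr hx hy subr0.
Qed.
HB.instance Definition _ := GRing.isZmodClosed.Build R ann_pred ann_zmod.

Fact ann_absorbing a : {in ann_pred, forall u, a * u \in ann_pred}.
Proof.
by move=> u; rewrite /in_mem /= /ann_pred => /eqP hu; rewrite mulrCA hu mulr0.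
Qed.
HB.instance Definition _ := isAbsorbing.Build R ann_pred ann_absorbing.

Definition ann : ideal R := (ann_pred : {pred _}).

(* the map R / R[h] -> R induced by x |-> h x; it is injective with image h R *)
Definition mulh (x : quot_ring ann) : R := h%:R * repr (x : {quot ann}).

Lemma mulh_proj r : mulh (quot_proj ann r) = h%:R * r.
Proof.
apply/eqP; rewrite -subr_eq0 -mulrBr.
suff : repr (quot_proj ann r : {quot ann}) - r \in ann by [].
by apply/quot_proj_eq; rewrite /quot_proj reprK.
Qed.

Lemma mulh_inj : injective mulh.
Proof.
move=> x y; have [a ->] := quot_projW x; have [b ->] := quot_projW y.
rewrite !mulh_proj => /eqP; rewrite -subr_eq0 -mulrBr => hab.
exact/quot_proj_eq.
Qed.

(* C / h: the unique matrix over R / R[h] that [mulh] sends to C *)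
Definition mxdivn n (C : 'M[R]_n) : 'M[quot_ring ann]_n :=
  xget 0 [set D | map_mx mulh D = C].

Lemma mxdivnP n (C : 'M[R]_n) :
  (forall i j, exists r, C i j = h%:R * r) ->
  forall D, map_mx mulh D = C <-> D = mxdivn C.
Proof.
move=> hC; have CD : map_mx mulh (mxdivn C) = C.
  rewrite /mxdivn; apply: (@xgetPex _ 0 [set D | map_mx mulh D = C]).
  have [f fP] := choice (fun ij : 'I_n * 'I_n => hC ij.1 ij.2).
  exists (\matrix_(i, j) quot_proj ann (f (i, j))).
  by apply/matrixP => i j; rewrite !mxE mulh_proj -(fP (i, j)).
move=> D; split=> [DC|->//].
apply/matrixP => i j; apply: mulh_inj.
by have /matrixP/(_ i j) := etrans DC (esym CD); rewrite !mxE.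
Qed.

(* generation of a module over R / R[h] by g elements, R acting through
   R -> R / R[h] *)
Definition generated_by (V : lmodType (quot_ring ann)) (g : nat) : Prop :=
  exists v : 'I_g -> V, forall x : V, exists c : 'I_g -> R,
    x = \sum_i quot_proj ann (c i) *: v i.

End DivideByInteger.

Definition alternating_mx (R : comPzRingType) n (C : 'M[R]_n) : Prop :=
  C^T = - C /\ forall i, C i i = 0.

Definition C_symmetric (R : comPzRingType) n (C X : 'M[R]_n) : Prop :=
  X - X^T = C.

Definition Sur (A G : zmodType) : set (A -> G) :=
  [set f | zmod_morphism f /\ forall y, exists x, f x = y].

Section Torsion.
Variables (G : finZmodType) (h : nat).

Definition torsion_pred : G -> bool := fun x => x *+ h == 0.

Fact torsion_zmod : zmod_closed torsion_pred.
Proof.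
split=> [|x y]; first by rewrite /in_mem /= /torsion_pred mul0rn.
rewrite /in_mem /= /torsion_pred => /eqP hx /eqP hy.
by rewrite mulrnBl hx hy subr0.
Qed.
HB.instance Definition _ := GRing.isZmodClosed.Build G torsion_pred torsion_zmod.

(* G[h] *)
Definition torsion : Type := {x : G | torsion_pred x}.
HB.instance Definition _ := SubFinite.on torsion.
HB.instance Definition _ := [SubChoice_isSubZmodule of torsion by <:].

End Torsion.

Section ExteriorSquare.
Variable A : finZmodType.

(* the free abelian group on A * A *)
Let F := {ffun A * A -> int}.

Definition fgen (a b : A) : F := [ffun u => (u == (a, b))%:R].

Inductive extsq_rel : F -> Prop :=
| ExtsqDl a b c : extsq_rel (fgen (a + b) c - fgen a c - fgen b c)
| ExtsqDr a b c : extsq_rel (fgen a (b + c) - fgen a b - fgen a c)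
| ExtsqAlt a : extsq_rel (fgen a a).

(* the subgroup generated by the relations *)
Definition extsq_pred : F -> bool :=
  fun u => `[< forall N : zmodClosed F, (forall r, extsq_rel r -> r \in N) -> u \in N >].

Fact extsq_pred_zmod : zmod_closed extsq_pred.
Proof.
split=> [|x y]; first by apply/asboolP => N _; exact: rpred0.
move=> /asboolP Nx /asboolP Ny; apply/asboolP => N rN.
by rewrite rpredB ?Nx ?Ny.
Qed.
HB.instance Definition _ := GRing.isZmodClosed.Build F extsq_pred extsq_pred_zmod.
Definition extsq_relgroup : zmodClosed F := (extsq_pred : {pred _}).

Definition extsq : zmodType := {quot extsq_relgroup}.

End ExteriorSquare.

Section Probability.
Variables (K : realType) (d : measure_display) (Omega : measurableType d).
Variable P : probability Omega K.
Local Open Scope ereal_scope.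

Definition random_elt (R : base_ring) (N : Omega -> R) : Prop :=
  forall U, ring_borel R U -> measurable (N @^-1` U).

Definition balanced (eps : K) (R : comPzRingType) (N : Omega -> R) : Prop :=
  forall I : ideal R, maximal_ideal I -> forall r : quot_ring I,
    P [set w | quot_proj I (N w) = r] <= (1 - eps)%:E.

(* mutual independence of the N i, i ranging over D *)
Definition independent (R : base_ring) (T : finType) (D : {set T})
    (N : T -> Omega -> R) : Prop :=
  forall J : {set T}, J \subset D ->
  forall U : T -> set R, (forall i, i \in J -> ring_borel R (U i)) ->
    P [set w | forall i, i \in J -> U i (N i w)] =
    \prod_(i in J) P [set w | U i (N i w)].

End Probability.

(* Main.v *)
From HB Require Import structures.
From mathcomp Require Import separable cyclotomic algC.
Require Import Defs.
From mathcomp Require Import all_boot all_order all_algebra all_fingroup all_solvable.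
From mathcomp Require Import finmap.
From mathcomp Require Import all_classical all_reals all_analysis measurable_realfun.
From mathcomp Require Import complex.
From mathcomp Require Import ring lra zify.
Import Order.TTheory GRing.Theory Num.Theory.
Import numFieldNormedType.Exports.
Local Open Scope ring_scope.
Set Implicit Arguments.
Unset Strict Implicit.
Unset Printing Implicit Defensive.

(** A surjection from coker X to G is a word F of n elements that generates G
and is killed by X, that is F X = 0. Only X modulo the exponent m of G matters,
so the expectation is the sum over generating words F of the probability that
F X = 0 (counting_Sur, expectation_moment).

Fix a perfect pairing b of G with itself, with values in Z/m
(perfect_pairing), and a primitive m-th root of unity. Fourier inversion turns
the probability into an average over words A (moment_fourier). By independence
of the entries on and above the diagonal, the term of (F, A) is a phase, which
comes from C, times the product of the Fourier coefficients of the laws of the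
entries X_ij, taken at beta (w_i, w_j) if i < j and at q (w_i) if i = j. Here
w_i = (F_i, A_i), q (x, a) = b (a, x) is the hyperbolic quadratic form on
G x G, and beta is its polar form. As the entries are balanced, a coefficient
at a nonzero frequency is at most a constant smaller than 1 (balanced_class,
hat_gap), so a term is exponentially small in the number of clashes of w, i.e.
of pairs and positions with a nonzero frequency.

The heart of the proof is that the words w that do not lie in a Lagrangian
subgroup of G x G are negligible altogether (clash_estimate, clash_limit).
Call a letter frequent if it occurs at least n / k times, for a large constant
k. If two frequent letters clash, there are quadratically many clashes.
Otherwise the frequent letters are pairwise orthogonal, so there are at most
|G| of them. If there are fewer, then there are exponentially fewer than |G|^n
such words. If there are |G| of them, they form a subgroup that is its own
orthogonal, and every letter outside of it causes linearly many clashes, as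
does a frequent letter where q does not vanish.

If F generates G and w lies in a Lagrangian subgroup, this subgroup is the graph
of an endomorphism phi of G that is alternating: b (phi x, x) = 0
(isotropic_generates). So the moment is, up to o(1), the sum over alternating
phi of the average over all F of the character of the sum over i < j of
C_ij b (phi F_i, F_j). If h phi = 0, this is 1. If not, Weyl differencing bounds
the square of the average by the proportion of the words that C annihilates for
the form b (phi x, y); such a word is determined by its pairings with
generators of the cokernel of C/h, up to the radical of the nonzero form
h b (phi x, y), so this proportion is at most 2^-(n - g_n)
(phase_average_small).

The limit is therefore the number of alternating phi with h phi = 0, i.e. of
alternating forms on G / hG. This quotient is isomorphic to G[h]
(torsion_projection), and by duality a finite abelian group has as many
alternating forms as its exterior square has elements (counting_extsq). *)

(** * Biadditive maps and scaling by residues *)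

Section BiadditiveTheory.
Variables (A B V : zmodType).

Lemma zmod_morph0 (f : A -> B) : zmod_morphism f -> f 0 = 0.
Proof. by move=> fB; rewrite -(subrr 0) fB subrr. Qed.

Lemma zmod_morphN (f : A -> B) : zmod_morphism f -> {morph f : x / - x}.
Proof. by move=> fB x; rewrite -sub0r fB (zmod_morph0 fB) sub0r. Qed.

Lemma zmod_morphD (f : A -> B) : zmod_morphism f -> {morph f : x y / x + y}.
Proof. by move=> fB x y; rewrite -{1}[y]opprK fB (zmod_morphN fB) opprK. Qed.

Lemma zmod_morphMn (f : A -> B) n : zmod_morphism f -> {morph f : x / x *+ n}.
Proof.
move=> fB x; elim: n => [|n IHn]; first by rewrite !mulr0n (zmod_morph0 fB).
by rewrite !mulrS (zmod_morphD fB) IHn.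
Qed.

Lemma zmod_morph_sum (f : A -> B) (I : Type) (r : seq I) (P : pred I) E :
  zmod_morphism f -> f (\sum_(i <- r | P i) E i) = \sum_(i <- r | P i) f (E i).
Proof.
move=> fB; exact: (big_morph f (zmod_morphD fB) (zmod_morph0 fB)).
Qed.

Lemma zmod_morphismP (f : A -> B) : {morph f : x y / x + y} -> zmod_morphism f.
Proof.
move=> fD x y; apply: (@addIr _ (f y)); rewrite subrK -fD subrK //.
Qed.

Definition biadditive (b : A -> B -> V) : Prop :=
  (forall x, zmod_morphism (b x)) /\ (forall y, zmod_morphism (b ^~ y)).

End BiadditiveTheory.

Definition perfect (A V : zmodType) (b : A -> A -> V) : Prop :=
  [/\ biadditive b, forall x y, b x y = b y x
    & forall x, (forall y, b x y = 0) -> x = 0].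

Section ModularScaling.
Variables (m : nat) (m_gt1 : (1 < m)%N).

Lemma natr_Zm_mod k : (k%:R : 'Z_m) = (k %% m)%N :> nat.
Proof. by rewrite val_Zp_nat. Qed.

Lemma Zm_natr_eq0 k : ((k%:R : 'Z_m) == 0) = (m %| k)%N.
Proof. by rewrite -val_eqE /= natr_Zm_mod. Qed.

Section Scaling.
Variables (A : zmodType) (mA : forall x : A, x *+ m = 0).

Lemma mulrn_mod (x : A) k : x *+ (k %% m)%N = x *+ k.
Proof. by rewrite {2}(divn_eq k m) mulrnDr mulnC mulrnA mA mul0rn add0r. Qed.

Lemma mulrn_natr (x : A) k : x *+ (k%:R : 'Z_m) = x *+ k.
Proof. by rewrite natr_Zm_mod mulrn_mod. Qed.

(** The residue a acts on a group of exponent dividing m through its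
    representative; the lemmas below say that this is a module structure. *)
Lemma mulrnZD (x : A) (a c : 'Z_m) : x *+ (a + c)%R = x *+ a + x *+ c.
Proof.
by rewrite -{1}(natr_Zp a) -{1}(natr_Zp c) -natrD mulrn_natr mulrnDr.
Qed.

Lemma mulrnZM (x : A) (a c : 'Z_m) : x *+ (a * c)%R = x *+ a *+ c.
Proof.
by rewrite -{1}(natr_Zp a) -{1}(natr_Zp c) -natrM mulrn_natr mulrnA.
Qed.

Lemma mulrnZB (x : A) (a c : 'Z_m) : x *+ (a - c)%R = x *+ a - x *+ c.
Proof. by apply: (@addIr _ (x *+ c)); rewrite -mulrnZD !subrK. Qed.

Lemma mulrzZ (x : A) (k : int) : x *~ k = x *+ (k%:~R : 'Z_m).
Proof.
case: k => k; first by rewrite -pmulrn mulrn_natr.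
by rewrite NegzE !mulrNz -!pmulrn -[- (k.+1%:R : 'Z_m)]sub0r mulrnZB sub0r mulrn_natr.
Qed.

End Scaling.

Lemma mulrn_Zm (a c : 'Z_m) : a *+ c = a * c.
Proof. by rewrite -{2}(natr_Zp c) mulr_natr. Qed.

End ModularScaling.

(** * Perfect pairings on finite abelian groups *)

Section PerfectPairing.
Variables (m : nat) (m_gt1 : (1 < m)%N) (A : finZmodType).
Hypothesis mA : forall x : A, x *+ m = 0.

(** Coordinates along a decomposition into cyclic groups. They are kept as
    natural numbers, so additivity and the coordinates of the generators hold
    only modulo the orders of the generators. *)
Lemma cyclic_coordinates : exists r (x : 'I_r -> A) (k : 'I_r -> A -> nat),
  [/\ forall y, y = \sum_i x i *+ k i y,
      forall i y z, (k i (y + z)%R = k i y + k i z %[mod #[x i]%g])%N,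
      forall i j, (k i (x j) = (i == j) %[mod #[x i]%g])%N
    & forall i, (#[x i]%g %| m)%N].
Proof.
have [s ds _] := abelian_structure (FinRing.zmod_abelian [set: A]).
move: ds; rewrite (big_nth 0) big_mkord => ds.
pose x (i : 'I_(size s)) := nth 0 s i.
have /choice[c cP] : forall y, exists c : 'I_(size s) -> A,
    [/\ forall i, c i \in <[x i]>%g, y = \sum_i c i &
      forall e, (forall i, e i \in <[x i]>%g) -> y = \sum_i e i ->
        forall i, e i = c i].
  move=> y; have [c [cin -> cu]] := mem_bigdprod ds (finset.in_setT y).
  exists c; split=> //; first by move=> i; exact: cin.
  by move=> e ein ye i; apply: cu => //; rewrite ye.
have /choice[k kP] : forall iy : 'I_(size s) * A,
    exists k : nat, c iy.2 iy.1 = x iy.1 *+ k.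
  move=> [i y] /=; have [/(_ i) ci _ _] := cP y.
  by have /cycleP[k ->] := ci; exists k.
exists (size s), x, (fun i y => k (i, y)); split.
- move=> y; have [_ ey _] := cP y; apply: etrans ey _.
  by apply: eq_bigr => i _; exact: (kP (i, y)).
- move=> i y z; apply/eqP; rewrite -eq_expg_mod_order; apply/eqP.
  rewrite !FinRing.zmodXgE mulrnDr -(kP (i, y + z)) -(kP (i, y)) -(kP (i, z)) /=.
  have [ciy ey _] := cP y; have [ciz ez _] := cP z; have [_ _ cu] := cP (y + z).
  rewrite -(cu (fun i => c y i + c z i)) //.
    by move=> j; exact: groupM.
  by rewrite {1}ey {1}ez big_split.
- move=> i j; apply/eqP; rewrite -eq_expg_mod_order; apply/eqP.
  rewrite !FinRing.zmodXgE -(kP (i, x j)) /=; have [_ _ cu] := cP (x j).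
  rewrite -(cu (fun i => x i *+ (i == j))) //.
    by move=> l; exact: mem_cycle.
  rewrite (bigD1 j) //= eqxx big1 ?addr0 // => l /negPf-> //.
- by move=> i; rewrite order_dvdn; apply/eqP; rewrite FinRing.zmodXgE mA.
Qed.

(** With o_i the order of the i-th generator, the pairing is the sum of
    (m / o_i) k_i(y) k_i(z): the factor m / o_i makes a summand insensitive to
    changes of the coordinates modulo o_i, and pairing y with the i-th
    generator recovers k_i(y). It lets the group serve as its own dual. *)
Lemma perfect_pairing : exists b : A -> A -> 'Z_m, perfect b.
Proof.
have [r [x [k [dec kD kx xm]]]] := cyclic_coordinates.
pose u i := (m %/ #[x i]%g)%N.
have eqm i a a' : (a = a' %[mod #[x i]%g])%N -> (u i * a)%:R = (u i * a')%:R :> 'Z_m.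
  move=> aa'; apply: val_inj; rewrite /= !natr_Zm_mod // -(divnK (xm i)) -/(u i).
  by rewrite -!muln_modr aa'.
pose b y z : 'Z_m := \sum_i (u i * k i y)%:R * (k i z)%:R.
have bC y z : b y z = b z y.
  by apply: eq_bigr => i _; rewrite !natrM mulrAC.
have bD y : {morph (b^~ y) : a c / a + c}.
  move=> a c; rewrite /b -big_split /=; apply: eq_bigr => i _.
  by rewrite (eqm _ _ _ (kD i a c)) -mulrDl mulnDr natrD.
exists b; split=> //.
  split=> z; last exact: zmod_morphismP (bD z).
  by move=> a c; rewrite ![b z _]bC; exact: zmod_morphismP (bD z) a c.
move=> y by0; rewrite (dec y) big1 // => i _.
have := by0 (x i); rewrite bC /b (bigD1 i) //= big1 => [|j /negPf ji].
  rewrite (eqm _ _ _ (kx i i)) eqxx muln1 addr0 -natrM => /eqP.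
  rewrite Zm_natr_eq0 // -{1}(divnK (xm i)) -/(u i) dvdn_pmul2l.
    by rewrite order_dvdn FinRing.zmodXgE => /eqP.
  by rewrite divn_gt0 ?order_gt0 // dvdn_leq // ltnW.
by rewrite (eqm _ _ _ (kx j i)) ji muln0 mul0r.
Qed.

End PerfectPairing.

(** * Characters, orthogonality and orthogonal subgroups *)

Lemma prim_root_exists (F : numClosedFieldType) (n : nat) :
  (0 < n)%N -> exists z : F, n.-primitive_root z.
Proof.
move=> n_gt0; pose p : {poly F} := 'X^n - 1.
have [r Dp] := closed_field_poly_normal p.
rewrite (lead_coefXnsubC _ n_gt0) scale1r in Dp.
have rn1 : all n.-unity_root r.
  by apply/allP => z; rewrite -root_prod_XsubC -Dp.
have sz_r : (n < (size r).+1)%N.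
  by rewrite -(size_prod_XsubC r id) -Dp size_XnsubC.
have [|z] := hasP (has_prim_root n_gt0 rn1 _ sz_r); last by exists z.
by rewrite -separable_prod_XsubC -Dp cyclotomic.separable_Xn_sub_1 // pnatr_eq0 -lt0n.
Qed.

Section Subgroups.
Variable A : finZmodType.

Definition subgr (S : {set A}) : Prop :=
  0 \in S /\ forall x y, x \in S -> y \in S -> x - y \in S.

Lemma subgrN S x : subgr S -> x \in S -> - x \in S.
Proof. by move=> [S0 SB] xS; rewrite -sub0r SB. Qed.

Lemma subgrD S x y : subgr S -> x \in S -> y \in S -> x + y \in S.
Proof. by move=> gS xS yS; rewrite -[y]opprK gS.2 // subgrN. Qed.

Lemma subgrMn S x k : subgr S -> x \in S -> x *+ k \in S.
Proof.
move=> gS xS; elim: k => [|k IHk]; first exact: gS.1.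
by rewrite mulrS subgrD.
Qed.

Lemma subgr_sum S (I : Type) (r : seq I) (P : pred I) (E : I -> A) :
  subgr S -> (forall i, P i -> E i \in S) -> \sum_(i <- r | P i) E i \in S.
Proof.
move=> gS ES; elim/big_ind: _ => //; first exact: gS.1.
by move=> x y; exact: subgrD.
Qed.

Lemma subgr_setT : subgr [set: A].
Proof. by split=> [|x y _ _]; rewrite finset.in_setT. Qed.

End Subgroups.

Section Characters.
Variables (C : numClosedFieldType) (m : nat) (m_gt1 : (1 < m)%N).
Variables (z : C) (z_prim : m.-primitive_root z).

Definition chi (a : 'Z_m) : C := z ^+ a.

Lemma chi0 : chi 0 = 1. Proof. by []. Qed.

Lemma chi_natr k : chi k%:R = z ^+ k.
Proof. by rewrite /chi natr_Zm_mod // (prim_expr_mod z_prim). Qed.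

Lemma chiD a c : chi (a + c) = chi a * chi c.
Proof.
by rewrite -{1}(natr_Zp a) -{1}(natr_Zp c) -natrD chi_natr exprD.
Qed.

Lemma chi_sum (I : Type) (r : seq I) (P : pred I) E :
  chi (\sum_(i <- r | P i) E i) = \prod_(i <- r | P i) chi (E i).
Proof. exact: (big_morph chi chiD chi0). Qed.

Lemma chi_eq1 a : (chi a == 1) = (a == 0).
Proof.
rewrite -(prim_order_dvd z_prim) -val_eqE /= /dvdn modn_small //.
by rewrite -[X in (_ < X)%N](Zp_cast m_gt1).
Qed.

Lemma norm_chi a : `|chi a| = 1.
Proof.
rewrite /chi normrX; suff -> : `|z| = 1 by rewrite expr1n.
have : `|z| ^+ m = 1 by rewrite -normrX (prim_expr_order z_prim) normr1.
by move/eqP; rewrite pexprn_eq1 // => /orP[|/eqP //]; case: (m) m_gt1.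
Qed.

Lemma chi_neq0 a : chi a != 0.
Proof. by rewrite -normr_eq0 norm_chi oner_eq0. Qed.

Lemma chiN a : chi (- a) = (chi a)^*.
Proof.
apply: (mulfI (chi_neq0 a)); rewrite -chiD subrr chi0.
by rewrite -normCK norm_chi expr1n.
Qed.

Section SubgroupSums.
Variable A : finZmodType.

(** Translating the sum by an element where f does not vanish multiplies it
    by a number different from 1, so it is 0. *)
Lemma sum_chi (S : {set A}) (f : A -> 'Z_m) : subgr S -> zmod_morphism f ->
  \sum_(x in S) chi (f x) = if [forall x in S, f x == 0] then #|S|%:R else 0.
Proof.
move=> gS fB; case: ifPn => [/forall_inP f0|].
  under eq_bigr => x xS do rewrite (eqP (f0 x xS)) chi0.
  by rewrite sumr_const.
rewrite negb_forall_in => /exists_inP[x0 x0S fx0].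
set T := (X in X = _).
have : T = chi (f x0) * T.
  rewrite /T mulr_sumr (reindex_inj (addrI x0)) /=.
  apply: eq_big => [x|x _]; last by rewrite (zmod_morphD fB) chiD.
  apply/idP/idP => xS; last exact: subgrD.
  by rewrite -[x](addKr x0) subgrD // subgrN.
move/eqP; rewrite -subr_eq0 -{1}[T]mul1r -mulrBl mulf_eq0 subr_eq0 eq_sym.
by rewrite chi_eq1 (negPf fx0) => /eqP.
Qed.

Lemma sum_chi_all (f : A -> 'Z_m) : zmod_morphism f ->
  \sum_x chi (f x) = if [forall x, f x == 0] then #|A|%:R else 0.
Proof.
move=> fB; have := sum_chi (subgr_setT A) fB; rewrite cardsT.
rewrite (eq_bigl predT) => [->|x]; last by rewrite finset.in_setT.
by congr (if _ then _ else _); apply: eq_forallb => x; rewrite finset.in_setT.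
Qed.

Section Perfect.
Variables (b : A -> A -> 'Z_m) (bP : perfect b).

Lemma sum_chi_perfect x :
  \sum_y chi (b x y) = if x == 0 then #|A|%:R else 0.
Proof.
have [[bBr bBl] _ b_nd] := bP.
rewrite (sum_chi_all (bBr x)); congr (if _ then _ else _).
apply/forallP/eqP => [bx0|-> y]; first by apply: b_nd => y; apply/eqP.
by rewrite (zmod_morph0 (bBl y)).
Qed.

(** If f were none of the maps b x, all the sums over y of
    chi (f y - b x y) would vanish; adding them over x leaves the single term
    y = 0, which is the order of the group. *)
Lemma perfect_represents_chi (f : A -> 'Z_m) : zmod_morphism f ->
  exists x, forall y, f y = b x y.
Proof.
have [[bBr bBl] bC b_nd] := bP.
move=> fB; apply: contrapT => /forallNP nrep.
have: \sum_x \sum_y chi (f y - b x y) = 0.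
  apply: big1 => x _; rewrite sum_chi_all; last first.
    by move=> y y'; rewrite fB (bBr x) !opprD !opprK addrACA.
  case: ifPn => // /forallP fx; case: (nrep x) => y.
  by apply/eqP; rewrite -subr_eq0 fx.
rewrite exchange_big /= (bigD1 0) //= [X in _ + X]big1 => [|y y0].
  under eq_bigr => x _ do
    rewrite (zmod_morph0 fB) (zmod_morph0 (bBr x)) subrr chi0.
  rewrite addr0 sumr_const => /eqP; rewrite pnatr_eq0 => /eqP A0.
  by have := card0_eq A0 0; rewrite !inE.
under eq_bigr => x _ do rewrite chiD -(zmod_morphN (bBr x)) bC.
by rewrite -mulr_sumr sum_chi_perfect oppr_eq0 (negPf y0) mulr0.
Qed.

Definition perp (S : {set A}) : {set A} :=
  [set u | [forall v in S, b v u == 0]].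

Lemma perpP (S : {set A}) u : reflect (forall v, v \in S -> b v u = 0) (u \in perp S).
Proof.
rewrite inE; apply: (iffP forall_inP) => bS v vS; apply/eqP; last by rewrite bS.
exact: bS.
Qed.

Lemma subgr_perp (S : {set A}) : subgr (perp S).
Proof.
have [[bBr bBl] bC b_nd] := bP; split=> [|x y /perpP xS /perpP yS].
  by apply/perpP => v _; rewrite (zmod_morph0 (bBr v)).
by apply/perpP => v vS; rewrite (bBr v) xS // yS // subrr.
Qed.

(** The sum of chi (b v u) over v in S and all u, computed in both orders. *)
Lemma card_perp_chi (S : {set A}) : subgr S -> (#|S| * #|perp S|)%N = #|A|.
Proof.
have [[bBr bBl] bC b_nd] := bP.
move=> gS; apply/eqP; rewrite -(eqr_nat C) natrM; apply/eqP.
transitivity (\sum_u \sum_(v in S) chi (b v u)).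
  under eq_bigr => u _ do rewrite (sum_chi gS (bBl u)).
  rewrite -big_mkcond /= sumr_const mulr_natr; congr (_ *+ _).
  by apply: eq_card => u; rewrite !inE.
rewrite exchange_big /= (bigD1 0) /=; last exact: gS.1.
rewrite sum_chi_perfect eqxx big1 ?addr0 // => v /andP[_ /negPf v0].
by rewrite sum_chi_perfect v0.
Qed.

Lemma perpK_chi (S : {set A}) : subgr S -> perp (perp S) = S.
Proof.
have [_ bC _] := bP.
move=> gS; apply/esym/eqP; rewrite eqEcard; apply/andP; split.
  by apply/fintype.subsetP => x xS; apply/perpP => v /perpP vS; rewrite bC vS.
rewrite leq_eqVlt; apply/orP; left.
have := card_perp_chi (subgr_perp S); rewrite -(card_perp_chi gS) mulnC => /eqP.
rewrite eqn_pmul2r; first by rewrite eq_sym.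
by apply/card_gt0P; exists 0; exact: (subgr_perp S).1.
Qed.

End Perfect.
End SubgroupSums.
End Characters.

(** None of these three facts mentions characters; the roots of unity among
    the algebraic numbers provide the character that their proofs need. *)
Section Duality.
Variables (m : nat) (m_gt1 : (1 < m)%N) (A : finZmodType).
Variables (b : A -> A -> 'Z_m) (bP : perfect b).

Lemma card_perp (S : {set A}) : subgr S -> (#|S| * #|perp b S|)%N = #|A|.
Proof.
have [z z_prim] := prim_root_exists algC (ltnW m_gt1).
exact: (card_perp_chi m_gt1 z_prim bP).
Qed.

Lemma perpK (S : {set A}) : subgr S -> perp b (perp b S) = S.
Proof.
have [z z_prim] := prim_root_exists algC (ltnW m_gt1).
exact: (perpK_chi m_gt1 z_prim bP).
Qed.

Lemma perfect_represents (f : A -> 'Z_m) :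
  zmod_morphism f -> exists x, forall y, f y = b x y.
Proof.
have [z z_prim] := prim_root_exists algC (ltnW m_gt1).
exact: (perfect_represents_chi m_gt1 z_prim bP).
Qed.

End Duality.

(** * Words with few clashes lie in Lagrangian subgroups *)

Section ThresholdEstimate.
Variables (K : realFieldType) (m : nat) (m_gt1 : (1 < m)%N) (H : finZmodType).
Variables (beta : H -> H -> 'Z_m) (betaP : perfect beta) (q : H -> 'Z_m).
Variables (N : nat) (cardH : #|H| = (N * N)%N).
Variable n : nat.
Implicit Types (w : {ffun 'I_n -> H}) (J : {set H}).

Definition fiber w v : {set 'I_n} := [set i | w i == v].
Definition frequent L w : {set H} := [set v | L <= #|fiber w v|]%N.
Definition outside J w : nat := #|[set i | w i \notin J]|.
(** Ordered pairs are counted, so that a clash between two positions counts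
    twice: a factor s ^+ 2 per unordered pair becomes s per ordered pair. *)
Definition clashes w : nat :=
  (\sum_i #|[set j | (i != j) && (beta (w i) (w j) != 0%R)]|
   + #|[set i | q (w i) != 0%R]|)%N.
(** A set that is its own orthogonal is automatically a subgroup. *)
Definition lagrangian J : bool := (J == perp beta J) && [forall v in J, q v == 0].
(** These words carry the main term: with few clashes, a word can only have
    its letters in such a subgroup. *)
Definition isotropic_word w : bool :=
  [exists J, lagrangian J && [forall i, w i \in J]].

Lemma clashes_pair L J w u v : J = frequent L w -> u \in J -> v \in J ->
  beta u v != 0 -> (L * L.-1 <= clashes w)%N.
Proof.
move=> ->; rewrite !inE => Lu Lv buv; apply: leq_trans (leq_addr _ _).
apply: (@leq_trans (\sum_(i in fiber w u) L.-1)).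
  by rewrite sum_nat_const leq_mul2r Lu orbT.
rewrite [leqRHS](bigID (mem (fiber w u))) /=; apply: leq_trans (leq_addr _ _).
apply: leq_sum => i; rewrite inE => /eqP wi.
apply: (@leq_trans #|fiber w v :\ i|).
  move: Lv; rewrite (cardsD1 i (fiber w v)).
  rewrite -subn1 leq_subLR => /leq_trans; apply.
  by rewrite leq_add2r; case: (i \in _).

apply/subset_leq_card/fintype.subsetP => j; rewrite !inE wi => /andP[ji /eqP ->].
by rewrite eq_sym ji.
Qed.

(** A letter outside J, which is its own orthogonal, fails to be orthogonal
    to some letter of J, and that one occurs L times. *)
Lemma clashes_outside L J w : J = frequent L w -> J = perp beta J ->
  (outside J w * L <= clashes w)%N.
Proof.
move=> JL Jp; apply: leq_trans (leq_addr _ _).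
rewrite -sum_nat_const [leqRHS](bigID (mem [set i | w i \notin J])) /=.
apply: leq_trans (leq_addr _ _); apply: leq_sum => i; rewrite inE => wiJ.
have [v vJ bv] : exists2 v, v \in J & beta v (w i) != 0.
  apply/exists_inP; move: wiJ; apply: contraR; rewrite negb_exists_in.
  move=> /forall_inP b0; rewrite Jp; apply/perpP => v vJ.
  by apply/eqP; have := b0 v vJ; rewrite negbK.
have : (L <= #|fiber w v|)%N by move: (vJ); rewrite {1}JL inE.
move=> /leq_trans; apply; apply/subset_leq_card/fintype.subsetP => j.
have [_ bC _] := betaP.
rewrite !inE => /eqP wj; rewrite wj bC bv andbT.
by apply: contraNneq wiJ => ->; rewrite wj.
Qed.

Lemma clashes_diag L J w v : J = frequent L w -> v \in J -> q v != 0 ->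
  (L <= clashes w)%N.
Proof.
move=> ->; rewrite inE => Lv qv; apply: leq_trans (leq_addl _ _).
apply: leq_trans Lv _; apply/subset_leq_card/fintype.subsetP => i.
by rewrite !inE => /eqP ->.
Qed.

Lemma outside_frequent L w : (outside (frequent L w) w <= N * N * L)%N.
Proof.
rewrite -cardH -sum_nat_const /outside -sum1_card (partition_big w predT) //=.
apply: leq_sum => v _; rewrite sum1_card.
case: (boolP (v \in frequent L w)) => vL.
  rewrite eq_card0 // => i; apply/negP => /andP[wi /eqP wiv].
  by move: wi; rewrite inE wiv vL.
move: vL; rewrite inE -ltnNge => /ltnW; apply: leq_trans.
by apply/subset_leq_card/fintype.subsetP => i; rewrite !inE => /andP[].
Qed.

(** The generating function of the number of letters outside J. With a small
    value of s it bounds the number of words with few letters outside J, and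
    with s ^+ L it sums the clashes that these letters cause. *)
Lemma sum_outside J (s : K) :
  \sum_w s ^+ outside J w = (#|J|%:R + #|~: J|%:R * s) ^+ n.
Proof.
transitivity (\sum_(w : {ffun 'I_n -> H}) \prod_i (if w i \in J then 1 else s)).
  apply: eq_bigr => w _; rewrite [RHS](bigID (fun i => w i \in J)) /=.
  rewrite big1 ?mul1r => [|i ->//].
  under eq_bigr => i /negPf -> do [].
  by rewrite prodr_const; congr (_ ^+ _); apply: eq_card => i; rewrite !inE.
rewrite -(bigA_distr_bigA (fun (_ : 'I_n) v => if v \in J then 1 else s)) /=.
rewrite prodr_const card_ord; congr (_ ^+ _).
rewrite (bigID (mem J)) /=; congr (_ + _).
  by under eq_bigr => v -> do []; rewrite sumr_const.
under eq_bigr => v /negPf -> do [].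
rewrite sumr_const mulr_natl; congr (_ *+ _).
by apply: eq_card => v; rewrite !inE.
Qed.

Lemma N_gt0 : (0 < N)%N.
Proof.
have := cardH; case: (posnP N) => [->|//]; rewrite mul0n => /card0_eq/(_ 0).
by rewrite !inE.
Qed.

(** J is contained in its double orthogonal, hence in its orthogonal, and
    the orders of these two subgroups multiply to N ^ 2. *)
Lemma isotropic_card J : {in J &, forall u v, beta u v = 0} ->
  (#|J| < N)%N \/ #|J| = N /\ J = perp beta J.
Proof.
move=> J0; have gP S := subgr_perp betaP S.
have JsP : J \subset perp beta J.
  by apply/fintype.subsetP => u uJ; apply/perpP => v vJ; rewrite J0.
set P1 := perp beta J in JsP; pose P2 := perp beta P1.
have [_ bC _] := betaP.
have JsP2 : J \subset P2.
  by apply/fintype.subsetP => u uJ; apply/perpP => v /perpP vP; rewrite bC vP.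
have P2sP1 : P2 \subset P1.
  apply/fintype.subsetP => u /perpP uP; apply/perpP => v vJ; apply: uP.
  exact: (fintype.subsetP JsP).
have c12 : (#|P1| * #|P2|)%N = (N * N)%N by rewrite -cardH (card_perp m_gt1 betaP (gP J)).
have [l1 l2 l3] := And3 (subset_leq_card JsP) (subset_leq_card JsP2)
  (subset_leq_card P2sP1).
have [|NJ] := ltnP #|J| N; [by left | right].
have [eJ e1] : #|J| = N /\ #|P1| = N.
  by move: N_gt0; nia.
by split=> //; apply/eqP; rewrite eqEcard JsP eJ e1 /=.
Qed.

Lemma ler_exp (x y : K) k : 0 <= x -> x <= y -> x ^+ k <= y ^+ k.
Proof. by move=> x0 xy; rewrite lerXn2r ?nnegrE ?(le_trans x0 xy). Qed.

Variable (s : K) (s0 : 0 <= s) (s1 : s <= 1).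

(** One summand for each way in which the frequent letters of a word can fail
    to place it in a Lagrangian subgroup: two frequent letters clash; the
    frequent letters are fewer than N; some letter is not frequent; a frequent
    letter has a nonzero value under q. *)
Definition clash_bound (L : nat) : K :=
  (N%:R ^+ 2) ^+ n * s ^+ (L * L.-1)
  + (2 * N%:R ^+ 2) ^+ (N * N * L) * (N%:R - 2^-1) ^+ n
  + ((N%:R + N%:R ^+ 2 * s ^+ L) ^+ n - N%:R ^+ n)
  + N%:R ^+ n * s ^+ L.

Lemma ler_sum_const (T : finType) (P : pred T) (F : T -> K) (c : K) :
  (forall x, P x -> F x <= c) -> 0 <= c -> \sum_(x | P x) F x <= #|T|%:R * c.
Proof.
move=> Fc c0; apply: (@le_trans _ _ (\sum_(x | P x) c)); first exact: ler_sum.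
rewrite sumr_const mulr_natl ler_wpMn2l //; exact: max_card.
Qed.

(** Clashing frequent letters cause L * L.-1 clashes, which beats the number
    of all words. Otherwise the frequent letters J are pairwise orthogonal. If
    they are fewer than N, there are too few words, as all but N * N * L letters
    lie in J. If they are N in number, J is its own orthogonal, and each letter
    outside J, as well as each frequent letter where q is not 0, causes at least
    L clashes. *)
Lemma frequent_estimate L J :
  \sum_(w | ~~ isotropic_word w && (frequent L w == J)) s ^+ clashes w
    <= clash_bound L.
Proof.
have N0 := N_gt0.
have N1 : 1 <= N%:R :> K by rewrite ler1n.
have sX k : 0 <= s ^+ k <= 1 by rewrite exprn_ge0 ?exprn_ile1.
have B1 : 0 <= (N%:R ^+ 2) ^+ n * s ^+ (L * L.-1) :> K.
  by rewrite mulr_ge0 // ?exprn_ge0.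
have B2 : 0 <= (2 * N%:R ^+ 2) ^+ (N * N * L) * (N%:R - 2^-1) ^+ n :> K.
  by rewrite mulr_ge0 ?exprn_ge0 //; lra.
have B3 : 0 <= (N%:R + N%:R ^+ 2 * s ^+ L) ^+ n - N%:R ^+ n :> K.
  by rewrite subr_ge0 ler_exp // lerDl mulr_ge0 ?exprn_ge0.
have B4 : 0 <= N%:R ^+ n * s ^+ L :> K by rewrite mulr_ge0 ?exprn_ge0.
have cardW : #|{ffun 'I_n -> H}|%:R = (N%:R ^+ 2) ^+ n :> K.
  by rewrite card_ffun card_ord cardH natrX natrM -expr2.
have card_le J' : (#|J'| <= #|H|)%N by exact: max_card.
case: (boolP [forall u in J, forall v in J, beta u v == 0]) => [J0|]; last first.
  rewrite negb_forall_in => /exists_inP[u uJ].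
  rewrite negb_forall_in => /exists_inP[v vJ buv].
  apply: (@le_trans _ _ ((N%:R ^+ 2) ^+ n * s ^+ (L * L.-1))); last first.
    by rewrite /clash_bound; lra.
  rewrite -cardW; apply: ler_sum_const; last by have /andP[] := sX (L * L.-1)%N.
  move=> w /andP[_ /eqP Lw]; rewrite ler_wiXn2l //.
  exact: clashes_pair (esym Lw) uJ vJ buv.
have {}J0 : {in J &, forall u v, beta u v = 0}.
  move=> u v uJ vJ; apply/eqP; move/forall_inP: J0 => /(_ u uJ) /forall_inP.
  exact.
have [JN|[JN Jp]] := isotropic_card J0.
  apply: (@le_trans _ _ ((2 * N%:R ^+ 2) ^+ (N * N * L) * (N%:R - 2^-1) ^+ n));
    last by rewrite /clash_bound; lra.
  (* With weight 1 / T per letter outside J, these letters, however many, add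
     at most 1/2 to the N - 1 letters of J. *)
  pose T : K := 2 * N%:R ^+ 2.
  have T1 : 1 <= T by rewrite /T; nra.
  have T0 : 0 < T by apply: lt_le_trans T1.
  apply: (@le_trans _ _ (\sum_w T ^+ (N * N * L) * T^-1 ^+ outside J w)).
    rewrite big_mkcond /=; apply: ler_sum => w _.
    have TL : 0 <= T ^+ (N * N * L) * T^-1 ^+ outside J w.
      by rewrite mulr_ge0 // exprn_ge0 // ?invr_ge0 ltW.
    case: ifP => // /andP[_ /eqP Lw]; apply: (@le_trans _ _ 1).
      by have /andP[] := sX (clashes w).
    rewrite exprVn -ler_pdivrMr ?invr_gt0 ?exprn_gt0 // invrK mul1r.
    by rewrite ler_weXn2l // -Lw outside_frequent.
  rewrite -mulr_sumr sum_outside ler_wpM2l ?exprn_ge0 ?(ltW T0) //.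
  apply: ler_exp; first by rewrite addr_ge0 // mulr_ge0 // invr_ge0 ltW.
  have -> : N%:R - 2^-1 = (N%:R - 1) + 2^-1 :> K by lra.
  apply: lerD; first by rewrite -[1]/(1%:R) -natrB // ler_nat; lia.
  rewrite ler_pdivrMr // /T mulrA mulVf ?mul1r; last by rewrite pnatr_eq0.
  by rewrite -natrX ler_nat -mulnn -cardH card_le.
rewrite (bigID (fun w => [forall i, w i \in J])) /= addrC.
apply: (@le_trans _ _ (((N%:R + N%:R ^+ 2 * s ^+ L) ^+ n - N%:R ^+ n)
    + N%:R ^+ n * s ^+ L)); last by rewrite /clash_bound; lra.
have inJ w : [forall i, w i \in J] = (outside J w == 0)%N.
  rewrite cards_eq0; apply/forallP/eqP => [wJ|w0 i].
    by apply/setP => i; rewrite !inE wJ.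
  by apply/negPn; have /setP/(_ i) := w0; rewrite !inE => ->.
apply: lerD.
  pose y : K := \sum_(w : {ffun 'I_n -> H} | ~~ [forall i, w i \in J]) (s ^+ L) ^+ outside J w.
  apply: (@le_trans _ _ y).
    rewrite [leRHS]big_mkcond [leLHS]big_mkcond /=; apply: ler_sum => w _.
    case: (boolP [forall i, _]) => wJ; rewrite ?andbF ?andbT //=.
    case: ifP => [/andP[_ /eqP Lw]|_]; last by rewrite exprn_ge0 ?exprn_ge0.
    by rewrite -exprM ler_wiXn2l // mulnC (clashes_outside (esym Lw)).
  rewrite /y -(lerD2l (\sum_(w : {ffun 'I_n -> H} | [forall i, w i \in J]) (s ^+ L) ^+ outside J w)).
  have := sum_outside J (s ^+ L).
  rewrite (bigID (fun w : {ffun 'I_n -> H} => [forall i, w i \in J])) /= => ->.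
  rewrite JN.
  under [X in _ <= X + _]eq_bigr => w wJ do
    rewrite (eqP (etrans (esym (inJ w)) wJ)) expr0.
  rewrite sumr_const.
  have -> : #|[pred w : {ffun 'I_n -> H} | [forall i, w i \in J]]|
      = (N ^ n)%N.
    rewrite -JN -[in RHS](card_ord n) -card_ffun_on; apply: eq_card => w.
    by apply/forallP/ffun_onP.
  rewrite natrX addrCA subrr addr0.
  apply: ler_exp; first by rewrite addr_ge0 // mulr_ge0 ?exprn_ge0.
  rewrite lerD2l ler_wpM2r ?exprn_ge0 // -natrX ler_nat -mulnn -cardH card_le //.
case: (boolP [forall v in J, q v == 0]) => [qJ|].
  rewrite big_pred0 // => w; apply/negP => /andP[/andP[/negP gw _] wJ]; apply: gw.
  by apply/existsP; exists J; rewrite /lagrangian -Jp eqxx qJ wJ.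
rewrite negb_forall_in => /exists_inP[v vJ qv].
apply: (@le_trans _ _ (\sum_(w : {ffun 'I_n -> H} | [forall i, w i \in J]) s ^+ L)).
  rewrite [leRHS]big_mkcond [leLHS]big_mkcond /=; apply: ler_sum => w _.
  case: (boolP [forall i, _]) => wJ; rewrite ?andbF ?andbT //=.
  case: ifP => [/andP[_ /eqP Lw]|_]; last by rewrite exprn_ge0.
  by rewrite ler_wiXn2l // (clashes_diag (esym Lw) vJ qv).
rewrite sumr_const -natrX mulr_natl -JN -[X in (_ ^ X)%N](card_ord n).
rewrite -card_ffun_on le_eqVlt; apply/orP; left; apply/eqP.
by congr (_ *+ _); apply: eq_card => w; apply/forallP/ffun_onP.
Qed.

Lemma clash_estimate L :
  \sum_(w | ~~ isotropic_word w) s ^+ clashes w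
    <= (2 ^ (N * N))%:R * clash_bound L.
Proof.
rewrite (partition_big (frequent L) predT) //=.
apply: (@le_trans _ _ (\sum_(J : {set H}) clash_bound L)).
  by apply: ler_sum => J _; exact: frequent_estimate.
rewrite sumr_const mulr_natl -cardH.
rewrite le_eqVlt; apply/orP; left; apply/eqP; congr (_ *+ _).
by rewrite -cardsT -powersetT card_powerset cardsT.
Qed.

End ThresholdEstimate.

(** * The hyperbolic form on G x G and generating words *)

HB.instance Definition _ (A B : finZmodType) := GRing.Zmodule.on (A * B)%type.

Section HyperbolicForm.
Variables (m : nat) (m_gt1 : (1 < m)%N) (G : finZmodType).
Variables (b : G -> G -> 'Z_m) (bP : perfect b).

(** The polar form of hyp_quad. Under the identification of G with its dual
    by b, hyp_quad is the evaluation pairing on the sum of G and its dual. *)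
Definition hyp_form (u v : G * G) : 'Z_m := b v.2 u.1 + b u.2 v.1.
Definition hyp_quad (u : G * G) : 'Z_m := b u.2 u.1.

Lemma hyp_formP : perfect hyp_form.
Proof.
have [[bBr bBl] bC b_nd] := bP.
have hC u v : hyp_form u v = hyp_form v u by rewrite /hyp_form addrC.
have hB u : zmod_morphism (hyp_form u).
  move=> [x a] [y c]; rewrite /hyp_form /= (bBl u.1) (bBr u.2).
  by rewrite opprD addrACA.
split=> //; first by split=> // v x y; rewrite !(hC _ v) hB.
move=> [x a] h0; congr (_, _); apply: b_nd => y.
  have := h0 (0, y); rewrite /hyp_form /= (zmod_morph0 (bBr a)) addr0 bC //.
have := h0 (y, 0); rewrite /hyp_form /= (zmod_morph0 (bBl x)) add0r //.
Qed.

Definition alternating_endo (phi : {ffun G -> G}) : bool :=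
  [forall x, forall y, phi (x - y) == phi x - phi y]
  && [forall x, b (phi x) x == 0].

Lemma alternating_endoP (phi : {ffun G -> G}) :
  reflect (zmod_morphism phi /\ forall x, b (phi x) x = 0)
    (alternating_endo phi).
Proof.
apply: (iffP andP) => [[/forallP pB /forallP pA]|[pB pA]]; split.
- by move=> x y; apply/eqP; move/forallP: (pB x).
- by move=> x; apply/eqP.
- by apply/forallP => x; apply/forallP => y; rewrite pB.
- by apply/forallP => x; rewrite pA.
Qed.

(** Polarization of b (phi x) x = 0. *)
Lemma alternating_endo_skew phi x y : alternating_endo phi ->
  b (phi x) y = - b (phi y) x.
Proof.
have [[bBr bBl] bC b_nd] := bP.
move=> /alternating_endoP[pB pA]; apply/eqP; rewrite -addr_eq0.
have := pA (x + y); rewrite (zmod_morphD pB) (zmod_morphD (bBl _)).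
by rewrite !(zmod_morphD (bBr _)) !pA addr0 add0r => ->.
Qed.

Section Words.
Variable n : nat.
Implicit Types F A : {ffun 'I_n -> G}.

Definition generates F : bool :=
  [forall y, [exists c : {ffun 'I_n -> 'Z_m}, y == \sum_i F i *+ c i]].

Definition zip_words F A : {ffun 'I_n -> G * G} := [ffun i => (F i, A i)].

Definition apply_word (phi : {ffun G -> G}) F : {ffun 'I_n -> G} :=
  [ffun i => phi (F i)].

(** A word that does not generate avoids some element altogether, since the
    letters lie in the subgroup that they generate. *)
Lemma card_nongenerating :
  (#|[pred F | ~~ generates F]| <= #|G| * #|G|.-1 ^ n)%N.
Proof.
rewrite -sum1_card big_mkcond -sum_nat_const /=.
apply: (@leq_trans (\sum_F \sum_(y : G) (F \in ffun_on (predC1 y)))%N).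
  apply: leq_sum => F _; case: ifP => //; rewrite inE negb_forall.
  case/existsP => y; rewrite negb_exists => /forallP yF.
  rewrite (bigD1 y) //= lt0n addn_eq0 negb_and eqb0 negbK; apply/orP; left.
  apply/ffun_onP => i; rewrite !inE; apply: contraNneq (yF [ffun j => (j == i)%:R]).
  move=> <-; rewrite (bigD1 i) //= big1 => [|j /negPf ji]; last first.
    by rewrite ffunE ji.
  by rewrite ffunE eqxx addr0.
rewrite exchange_big /=; apply: leq_sum => y _.
by rewrite -big_mkcond sum1_card card_ffun_on cardC1 card_ord.
Qed.

(** The Lagrangian subgroup J has the order of G and, as F generates, it
    projects onto G; so it is the graph of a map phi. This map is additive
    because J is a subgroup, and alternating because the quadratic form
    vanishes on J. *)
Lemma isotropic_generates F A : generates F ->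
  isotropic_word hyp_form hyp_quad (zip_words F A) ->
  exists2 phi, alternating_endo phi & A = apply_word phi F.
Proof.
have [[bBr bBl] bC b_nd] := bP.
move=> /forallP genF /existsP[J /andP[/andP[/eqP Jp /forall_inP qJ] /forallP wJ]].
have gJ : subgr J by rewrite Jp; apply: (subgr_perp hyp_formP).
have cJ : #|J| = #|G|.
  have := card_perp m_gt1 hyp_formP gJ; rewrite -Jp card_prod !mulnn => /eqP.
  by rewrite eqn_sqr => /eqP.
have Jex y : exists a, (y, a) \in J.
  have /existsP[c /eqP ->] := genF y.
  exists (\sum_i A i *+ c i).
  have -> : (\sum_i F i *+ c i, \sum_i A i *+ c i) =
      \sum_i zip_words F A i *+ c i.
    rewrite [RHS]surjective_pairing !raddf_sum /=.
    by congr (_, _); apply: eq_bigr => i _; rewrite raddfMn ffunE.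
  by apply: subgr_sum => // i _; apply: subgrMn.
have Juniq y a c : (y, a) \in J -> (y, c) \in J -> a = c.
  have /imset_injP finj : #|[set u.1 | u in J]| == #|J|.
    rewrite cJ -cardsT; apply/eqP; congr #|pred_of_set _|; apply/setP => x.
    by rewrite finset.in_setT; have [e xe] := Jex x; apply/imsetP; exists (x, e).
  by move=> ya yc; have [] : (y, a) = (y, c) by apply: finj.
have [phi phiJ] := choice Jex.
exists [ffun x => phi x].
  apply/alternating_endoP; split=> [x y|x]; last first.
    by rewrite ffunE; apply/eqP/(qJ (x, phi x)).
  rewrite !ffunE; apply: (Juniq (x - y)) => //.
  exact: (gJ.2 _ _ (phiJ x) (phiJ y)).
apply/ffunP => i; rewrite !ffunE; apply: (Juniq (F i)) => //.
by have := wJ i; rewrite ffunE.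
Qed.

Lemma apply_word_inj F : generates F ->
  {in alternating_endo &, injective (apply_word^~ F)}.
Proof.
move=> /forallP genF phi psi /alternating_endoP[phiB _] /alternating_endoP[psiB _].
move=> /ffunP e; apply/ffunP => y; have /existsP[c /eqP ->] := genF y.
rewrite (zmod_morph_sum _ _ _ phiB) (zmod_morph_sum _ _ _ psiB).
apply: eq_bigr => i _; rewrite (zmod_morphMn _ phiB) (zmod_morphMn _ psiB).
by have := e i; rewrite !ffunE => ->.
Qed.

End Words.
End HyperbolicForm.

(** * Fourier expansion of the moment *)

Section Moment.
Variables (L : comNzRingType) (m : nat) (G : finZmodType) (n : nat).
Variables (Cm : 'M['Z_m]_n) (mu : 'I_n -> 'I_n -> 'Z_m -> L).
Implicit Types (F : {ffun 'I_n -> G}) (x : {ffun 'I_n * 'I_n -> 'Z_m}).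

(** The symmetry condition determines the entries below the diagonal; the
    values of x there are ignored. *)
Definition entry x (i j : 'I_n) : 'Z_m :=
  if (i <= j)%N then x (i, j) else x (j, i) - Cm j i.

Definition kills F x : bool := [forall j, \sum_i F i *+ entry x i j == 0].

(** The expected number of generating words that a random matrix kills, for
    independent entries with laws mu. *)
Definition moment : L :=
  \sum_(F : {ffun 'I_n -> G} | generates m F) \sum_(x : {ffun 'I_n * 'I_n -> 'Z_m})
    (\prod_p mu p.1 p.2 (x p)) * (kills F x)%:R.

End Moment.

Section MomentExpansion.
Variables (C : numClosedFieldType) (m : nat) (m_gt1 : (1 < m)%N).
Variables (z : C) (z_prim : m.-primitive_root z).
Variables (G : finZmodType) (mG : forall x : G, x *+ m = 0).
Variables (b : G -> G -> 'Z_m) (bP : perfect b).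
Variables (n : nat) (Cm : 'M['Z_m]_n) (mu : 'I_n -> 'I_n -> 'Z_m -> C).
Implicit Types (F A : {ffun 'I_n -> G}) (x : {ffun 'I_n * 'I_n -> 'Z_m}).
Local Notation chi := (chi z).

Definition mu_hat i j (e : 'Z_m) : C := \sum_c mu i j c * chi (e * c).

(** The coefficient of the entry (i, j) in the pairing of the word A with F X:
    an off-diagonal entry occurs both in row i and in row j, which produces the
    polar form; a diagonal entry occurs once, which produces the quadratic form. *)
Definition exponent_coef F A (i j : 'I_n) : 'Z_m :=
  if (i < j)%N then hyp_form b (F i, A i) (F j, A j)
  else if i == j then hyp_quad b (F i, A i) else 0.

(** What the entries below the diagonal contribute through C. *)
Definition phase F A : 'Z_m := \sum_(p : 'I_n * 'I_n | (p.1 < p.2)%N)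
  b (A p.1) (F p.2) * Cm p.1 p.2.

Lemma phase_split F A x :
  \sum_j b (A j) (\sum_i F i *+ entry Cm x i j)
  = \sum_p exponent_coef F A p.1 p.2 * x p - phase F A.
Proof.
have [[bBr bBl] bC b_nd] := bP.
transitivity (\sum_(p : 'I_n * 'I_n) b (A p.2) (F p.1) * entry Cm x p.1 p.2).
  rewrite -(pair_bigA _ (fun i j => b (A j) (F i) * entry Cm x i j)) exchange_big /=.
  apply: eq_bigr => j _; rewrite (zmod_morph_sum _ _ _ (bBr _)).
  by apply: eq_bigr => i _; rewrite (zmod_morphMn _ (bBr _)) mulrn_Zm.
rewrite (bigID (fun p : 'I_n * 'I_n => (p.1 <= p.2)%N)) /=.
have swapI : injective (fun p : 'I_n * 'I_n => (p.2, p.1)) by move=> [? ?] [? ?] [-> ->].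
rewrite [X in _ + X](reindex_inj swapI) /= /phase [X in _ = _ - X]big_mkcond -sumrB.
rewrite big_mkcond [X in _ + X]big_mkcond -big_split /=.
apply: eq_bigr => -[i j] _ /=; rewrite /entry /exponent_coef /hyp_form /hyp_quad /=.
case: (ltngtP i j) => [ij|ij|/ord_inj ->].
- by rewrite /=; ring.
- have /negPf -> : i != j by rewrite neq_ltn ij orbT.
  by rewrite /=; ring.
- by rewrite eqxx /=; ring.
Qed.

(** Orthogonality of characters in each coordinate of F X. *)
Lemma indicator_fourier F x :
  (kills Cm F x)%:R = #|G|%:R ^- n *
    \sum_(A : {ffun 'I_n -> G}) chi (\sum_j b (A j) (\sum_i F i *+ entry Cm x i j)) :> C.
Proof.
have [[bBr bBl] bC b_nd] := bP.
have G0 : #|G|%:R != 0 :> C.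
  by rewrite pnatr_eq0 -lt0n; apply/card_gt0P; exists 0.
set y := fun j => \sum_i F i *+ entry Cm x i j.
have -> : \sum_(A : {ffun 'I_n -> G}) chi (\sum_j b (A j) (y j)) = \prod_j \sum_a chi (b a (y j)).
  rewrite (bigA_distr_bigA (fun j a => chi (b a (y j)))) /=.
  by apply: eq_bigr => A _; exact: (chi_sum m_gt1 z_prim).
under eq_bigr => j _.
  under eq_bigr => a _ do rewrite bC.
  rewrite (sum_chi_perfect m_gt1 z_prim bP).
over.
rewrite /kills; case: (boolP [forall j, _]) => [/forallP y0|].
  rewrite (eq_bigr (fun=> #|G|%:R)) => [|j _]; last first.
    by have -> : y j == 0 by exact: y0.
  by rewrite prodr_const card_ord mulVf // expf_neq0.
rewrite negb_forall => /existsP[j /negPf yj].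
have {}yj : (y j == 0) = false by exact: yj.
by rewrite (bigD1 j) //= yj mul0r mulr0.
Qed.

Definition fourier_term F A : C :=
  #|G|%:R ^- n * (chi (- phase F A) *
    \prod_p mu_hat p.1 p.2 (exponent_coef F A p.1 p.2)).

Lemma moment_fourier :
  moment G Cm mu = \sum_(F | generates m F) \sum_(A : {ffun 'I_n -> G}) fourier_term F A.
Proof.
apply: eq_bigr => F _.
under eq_bigr => x _ do rewrite indicator_fourier mulrCA mulr_sumr.
rewrite -mulr_sumr exchange_big /= mulr_sumr; apply: eq_bigr => A _.
congr (_ * _).
under eq_bigr => x _.
  rewrite phase_split addrC (chiD m_gt1 z_prim) mulrCA (chi_sum m_gt1 z_prim).
  rewrite -big_split /=.
over.
rewrite -mulr_sumr; congr (_ * _).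
by rewrite /mu_hat (bigA_distr_bigA (fun p c =>
  mu p.1 p.2 c * chi (exponent_coef F A p.1 p.2 * c))).
Qed.

Hypothesis mu1 : forall i j, \sum_c mu i j c = 1.
Variables (s : C) (s0 : 0 <= s) (s1 : s <= 1).
Hypothesis mu_s : forall (i j : 'I_n) (e : 'Z_m), (i <= j)%N -> e != 0 -> `|mu_hat i j e| <= s ^+ 2.

Lemma mu_hat0 i j : mu_hat i j 0 = 1.
Proof.
by rewrite -(mu1 i j); apply: eq_bigr => c _; rewrite mul0r chi0 mulr1.
Qed.

(** Each clash brings a Fourier coefficient at a nonzero frequency. Writing
    the off-diagonal factor s ^+ 2 as one factor s for (i, j) and one for (j, i)
    matches the count of clashes over ordered pairs. *)
Lemma norm_fourier_term F A :
  `|fourier_term F A| <=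
    #|G|%:R ^- n * s ^+ clashes (hyp_form b) (hyp_quad b) (zip_words F A).
Proof.
have [_ hC _] := hyp_formP bP.
rewrite normrM ger0_norm ?invr_ge0 ?exprn_ge0 // ler_wpM2l ?invr_ge0 ?exprn_ge0 //.
rewrite normrM (norm_chi m_gt1 z_prim) mul1r normr_prod.
set w := zip_words F A.
pose f (i j : 'I_n) := if (i != j) && (hyp_form b (w i) (w j) != 0) then s else 1.
have f0 i j : 0 <= f i j by rewrite /f; case: ifP.
have fC i j : f i j = f j i by rewrite /f eq_sym hC.
pose d i := if hyp_quad b (w i) != 0 then s else 1.
have -> : s ^+ clashes (hyp_form b) (hyp_quad b) w =
    (\prod_(p : 'I_n * 'I_n) f p.1 p.2) * \prod_i d i.
  rewrite exprD -(pair_bigA _ f) /= /f /d; congr (_ * _).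
    rewrite expr_sum; apply: eq_bigr => i _.
    by rewrite -big_mkcond /= prodr_const; congr (_ ^+ _);
      apply: eq_card => j; rewrite !inE.
  by rewrite -big_mkcond /= prodr_const; congr (_ ^+ _);
    apply: eq_card => j; rewrite !inE.
have -> : \prod_(p : 'I_n * 'I_n) f p.1 p.2 =
    \prod_(p : 'I_n * 'I_n) if (p.1 < p.2)%N then f p.1 p.2 ^+ 2 else 1.
  rewrite (bigID (fun p : 'I_n * 'I_n => (p.1 < p.2)%N)) /=.
  rewrite [X in _ * X](bigID (fun p : 'I_n * 'I_n => (p.2 < p.1)%N)) /=.
  rewrite [X in _ * (_ * X)]big1 => [|[i j] /=]; last first.
    by case: ltngtP => // /ord_inj -> _; rewrite /f eqxx.
  have swapI : injective (fun p : 'I_n * 'I_n => (p.2, p.1)).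
    by move=> [? ?] [? ?] [-> ->].
  rewrite mulr1 [X in _ * X](reindex_inj swapI) /= -big_mkcond /=.
  rewrite [X in _ * X](eq_bigl (fun p : 'I_n * 'I_n => (p.1 < p.2)%N)); last first.
    by move=> [i j] /=; case: ltngtP.
  by rewrite -big_split /=; apply: eq_bigr => p _; rewrite fC expr2.
have -> : \prod_i d i = \prod_(p : 'I_n * 'I_n) if p.1 == p.2 then d p.1 else 1.
  rewrite -(pair_bigA _ (fun i j => if i == j then d i else 1)) /=.
  apply: eq_bigr => i _; rewrite -big_mkcond /=.
  by under eq_bigl => j do rewrite eq_sym; rewrite big_pred1_eq.
rewrite -big_split /=; apply: ler_prod => -[i j] _ /=; rewrite normr_ge0 /=.
rewrite /exponent_coef /f /d !ffunE.
case: (ltngtP i j) => [ij|ij|/ord_inj ->].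
- have /negPf nij : i != j by rewrite neq_ltn ij.
  rewrite nij mulr1 /=; case: ifPn => [e0|].
    by rewrite mu_s // ltnW.
  by rewrite negbK => /eqP ->; rewrite mu_hat0 normr1 expr1n.
- have /negPf -> : i != j by rewrite neq_ltn ij orbT.
  by rewrite mu_hat0 normr1 mulr1.
- rewrite eqxx mul1r; case: ifPn => [e0|].
    by apply: le_trans (mu_s _ e0) _ => //; rewrite expr2 ler_piMl.
  by rewrite negbK => /eqP ->; rewrite mu_hat0 normr1.
Qed.

(** The terms A = phi o F for alternating phi, where all the Fourier
    coefficients are 1 and only the phase remains. The sum is over all F, as the words that do not
    generate are negligible. *)
Definition alternating_main : C :=
  \sum_(phi | alternating_endo b phi) #|G|%:R ^- n *
    \sum_(F : {ffun 'I_n -> G}) chi (- phase F (apply_word phi F)).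

Lemma fourier_term_alternating F phi : alternating_endo b phi ->
  fourier_term F (apply_word phi F) =
    #|G|%:R ^- n * chi (- phase F (apply_word phi F)).
Proof.
move=> altp; rewrite /fourier_term big1 ?mulr1 // => -[i j] _ /=.
have /alternating_endoP[_ pA] := altp.
rewrite /exponent_coef /hyp_form /hyp_quad /= !ffunE pA.
rewrite (alternating_endo_skew bP _ _ altp) addNr.
by case: ifP => _; [|case: ifP => _]; rewrite mu_hat0.
Qed.

(** A term with generating F is either one of the main ones or, by
    isotropic_generates, belongs to a word that is not isotropic. The second
    summand pays for the words that do not generate. *)
Lemma moment_main_bound :
  `|moment G Cm mu - alternating_main| <=
    #|G|%:R ^- n * \sum_(w : {ffun 'I_n -> G * G} |
        ~~ isotropic_word (hyp_form b) (hyp_quad b) w)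
      s ^+ clashes (hyp_form b) (hyp_quad b) w
    + #|alternating_endo b|%:R * (#|G| * #|G|.-1 ^ n)%:R
      * #|G|%:R ^- n.
Proof.
have Gn0 : 0 <= #|G|%:R ^- n :> C by rewrite invr_ge0 exprn_ge0.
pose B (F : {ffun 'I_n -> G}) := [set apply_word phi F | phi in alternating_endo b].
have split_moment : moment G Cm mu =
    \sum_(F | generates m F) \sum_(phi | alternating_endo b phi)
      #|G|%:R ^- n * chi (- phase F (apply_word phi F))
    + \sum_(F | generates m F) \sum_(A | A \notin B F) fourier_term F A.
  rewrite moment_fourier -big_split /=; apply: eq_bigr => F genF.
  rewrite (bigID (mem (B F))) /=; congr (_ + _).
  rewrite big_imset /=; last exact: apply_word_inj genF.
  by apply: eq_bigr => phi altp; exact: fourier_term_alternating.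
have -> : moment G Cm mu - alternating_main =
   \sum_(F | generates m F) \sum_(A | A \notin B F) fourier_term F A
   - \sum_(phi | alternating_endo b phi) #|G|%:R ^- n *
       \sum_(F : {ffun 'I_n -> G} | ~~ generates m F)
         chi (- phase F (apply_word phi F)).
  rewrite split_moment exchange_big /= /alternating_main.
  under eq_bigr => phi _ do rewrite -mulr_sumr.
  under [X in _ - X]eq_bigr => phi _ do rewrite (bigID (@generates m G n)) /= mulrDr.
  rewrite big_split /=; ring.
apply: le_trans (ler_normB _ _) _; apply: lerD.
  apply: le_trans (ler_norm_sum _ _ _) _.
  rewrite mulr_sumr.
  apply: (@le_trans _ _ (\sum_(F | generates m F) \sum_(A | A \notin B F)
      #|G|%:R ^- n * s ^+ clashes (hyp_form b) (hyp_quad b) (zip_words F A))).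
    apply: ler_sum => F _; apply: le_trans (ler_norm_sum _ _ _) _.
    by apply: ler_sum => A _; exact: norm_fourier_term.
  rewrite pair_big_dep /=.
  pose unzip (w : {ffun 'I_n -> G * G}) : {ffun 'I_n -> G} * {ffun 'I_n -> G} :=
    ([ffun i => (w i).1], [ffun i => (w i).2]).
  pose zip (FA : {ffun 'I_n -> G} * {ffun 'I_n -> G}) := zip_words FA.1 FA.2.
  have zipK : cancel zip unzip.
    by move=> [F A]; congr (_, _); apply/ffunP => i; rewrite !ffunE.
  have unzipK : cancel unzip zip.
    by move=> w; apply/ffunP => i; rewrite !ffunE -surjective_pairing.
  rewrite [leRHS](reindex zip); last by exists unzip => ? _; [exact: zipK|exact: unzipK].
  rewrite [leLHS]big_mkcond [leRHS]big_mkcond /=; apply: ler_sum => -[F A] _ /=.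
  case: ifP => [/andP[genF AB]|_]; last first.
    by case: ifP => // _; rewrite mulr_ge0 // exprn_ge0.
  case: ifPn => //; rewrite negbK => /(isotropic_generates m_gt1 bP genF).
  by case=> phi altp eA; case/imsetP: AB; exists phi.
apply: le_trans (ler_norm_sum _ _ _) _.
apply: (@le_trans _ _ (\sum_(phi | alternating_endo b phi)
    (#|G| * #|G|.-1 ^ n)%:R * #|G|%:R ^- n)).
  apply: ler_sum => phi _; rewrite normrM ger0_norm // mulrC ler_wpM2r //.
  apply: le_trans (ler_norm_sum _ _ _) _.
  under eq_bigr => F _ do rewrite (norm_chi m_gt1 z_prim).
  by rewrite sumr_const ler_nat card_nongenerating.
by rewrite sumr_const -mulrA [leRHS]mulr_natl.
Qed.

End MomentExpansion.

(** * Averages of the phase of an alternating endomorphism *)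

Section FiberCounting.

Lemma card_fibers_le (T U : finType) (f : T -> U) (S : {set T}) k :
  (forall y, y \in S -> #|[set x in S | f x == f y]| <= k)%N ->
  (#|S| <= #|f @: S| * k)%N.
Proof.
move=> fk; rewrite -sum_nat_const -sum1_card.
rewrite (partition_big f (mem (f @: S))) /=; last first.
  by move=> x xS; apply: imset_f.
apply: leq_sum => _ /imsetP[y yS ->]; apply: leq_trans (fk y yS).
by rewrite sum1_card subset_leq_card //; apply/fintype.subsetP => x; rewrite !inE.
Qed.

Lemma card_image_kernel (A : finZmodType) (B : finType) (f : A -> B) (S : {set A}) :
  (forall x y, (f x == f y) = (x - y \in S)) ->
  (#|f @: [set: A]| * #|S|)%N = #|A|.
Proof.
move=> fS; rewrite -[RHS]sum1_card (partition_big f (mem (f @: [set: A]))) /=.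
  rewrite -sum_nat_const; apply: eq_bigr => _ /imsetP[y _ ->].
  rewrite -(card_imset (pred_of_set S) (addIr y)) sum1_card.
  apply: eq_card => x; transitivity (x - y \in S); last by rewrite -fS.
  apply/imsetP/idP => [[u uS ->]|xS]; first by rewrite addrK.
  by exists (x - y); rewrite ?subrK.
by move=> x _; apply: imset_f; rewrite finset.in_setT.
Qed.

End FiberCounting.

Section PhaseAverage.
Variables (C : numClosedFieldType) (m : nat) (m_gt1 : (1 < m)%N).
Variables (z : C) (z_prim : m.-primitive_root z).
Variables (G : finZmodType) (mG : forall x : G, x *+ m = 0).
Variables (b : G -> G -> 'Z_m) (bP : perfect b).
Variables (n : nat) (Cm D : 'M['Z_m]_n) (h : nat).
Hypothesis CD : forall i j, Cm i j = h%:R * D i j.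
Hypothesis C_skew : forall i j, Cm j i = - Cm i j.
Hypothesis C_diag : forall i, Cm i i = 0.
Variables (phi : {ffun G -> G}) (altp : alternating_endo b phi).
Implicit Types (F Z : {ffun 'I_n -> G}).
Local Notation chi := (chi z).

Let B x y := b (phi x) y.

Lemma pull_biadditive : biadditive B.
Proof.
have [[bBr bBl] _ _] := bP; have [/(_ _ _) pB _] := alternating_endoP b phi altp.
by split=> [x|y] u v; rewrite /B ?bBr // pB bBl.
Qed.

Let Q F := phase b Cm F (apply_word phi F).
Let row_comb F (i : 'I_n) : G := \sum_j F j *+ Cm i j.

Lemma phase_killed F : (forall x, phi x *+ h = 0) -> Q F = 0.
Proof.
have [[bBr bBl] _ _] := bP.
move=> hp; apply: big1 => p _; rewrite ffunE CD mulrA mulr_natr.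
by rewrite -(zmod_morphMn _ (bBl _)) hp (zmod_morph0 (bBl _)) mul0r.
Qed.

(** The phase of phi is the quadratic form of the alternating matrix C with
    values in the alternating form B; both signs cancel when i and j are
    exchanged, so its polar form is the full double sum. *)
Lemma phase_polarization F Z :
  Q (F + Z) = Q F + Q Z + \sum_i B (F i) (row_comb Z i).
Proof.
have [BBr BBl] := pull_biadditive.
have -> : \sum_i B (F i) (row_comb Z i) =
    \sum_(p : 'I_n * 'I_n) B (F p.1) (Z p.2) * Cm p.1 p.2.
  rewrite -(pair_bigA _ (fun i j => B (F i) (Z j) * Cm i j)) /=.
  apply: eq_bigr => i _; rewrite (zmod_morph_sum _ _ _ (BBr _)).
  by apply: eq_bigr => j _; rewrite (zmod_morphMn _ (BBr _)) mulrn_Zm.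
rewrite (bigID (fun p : 'I_n * 'I_n => (p.1 < p.2)%N)) /=.
rewrite [X in _ + (_ + X)](bigID (fun p : 'I_n * 'I_n => (p.2 < p.1)%N)) /=.
rewrite [X in _ + (_ + (_ + X))]big1 => [|[i j] /=]; last first.
  by case: ltngtP => // /ord_inj -> _; rewrite C_diag mulr0.
have swapI : injective (fun p : 'I_n * 'I_n => (p.2, p.1)).
  by move=> [? ?] [? ?] [-> ->].
rewrite addr0 [X in _ + (_ + X)](reindex_inj swapI) /=.
rewrite [X in _ + (_ + X)](eq_bigl (fun p : 'I_n * 'I_n => (p.1 < p.2)%N));
  last by move=> [i j] /=; case: ltngtP.
rewrite /Q /phase -!big_split /=; apply: eq_bigr => -[i j] _ /=.
rewrite !ffunE -/(B _ _) (zmod_morphD (BBl _)) !(zmod_morphD (BBr _)).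
rewrite [Cm j i]C_skew [B (F j) (Z i)](alternating_endo_skew bP _ _ altp) -/(B _ _).
by rewrite /B; ring.
Qed.

(** The directions Z in which the difference of the phase between F + Z and F
    does not depend on F. *)
Definition phase_null : {set {ffun 'I_n -> G}} :=
  [set Z : {ffun 'I_n -> G} | [forall i, forall x, b (phi x) (\sum_j Z j *+ Cm i j) == 0]].

Lemma phase_nullP Z :
  reflect (forall i x, B x (row_comb Z i) = 0) (Z \in phase_null).
Proof.
rewrite inE; apply: (iffP forallP) => [Z0 i x|Z0 i].
  exact/eqP/(forallP (Z0 i) x).
by apply/forallP => x; apply/eqP; exact: Z0.
Qed.

Lemma sum_polarized Z :
  `|\sum_(F : {ffun 'I_n -> G}) chi (- (\sum_i B (F i) (row_comb Z i)))|
    <= if Z \in phase_null then #|G|%:R ^+ n else 0.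
Proof.
have [BBr BBl] := pull_biadditive.
have -> : \sum_(F : {ffun 'I_n -> G}) chi (- (\sum_i B (F i) (row_comb Z i))) =
    \prod_i \sum_x chi (- B x (row_comb Z i)).
  rewrite (bigA_distr_bigA (fun i x => chi (- B x (row_comb Z i)))) /=.
  apply: eq_bigr => F _; rewrite -sumrN; exact: (chi_sum m_gt1 z_prim).
have BN y : zmod_morphism (fun x => - B x y).
  by move=> u v; rewrite /= BBl opprD.
case: ifPn => [Z0|].
  rewrite normr_prod -[n in leRHS](card_ord n) -prodr_const.
  apply: ler_prod => i _; rewrite normr_ge0 (sum_chi_all m_gt1 z_prim (BN _)).
  by case: ifP => _ /=; rewrite ?normr0 ?normr_nat ?lexx ?ler0n.
rewrite inE negb_forall; case/existsP => i; rewrite negb_forall; case/existsP => x Bx.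
rewrite (bigD1 i) //= (sum_chi_all m_gt1 z_prim (BN _)) ifN ?mul0r ?normr0 //.
by rewrite negb_forall; apply/existsP; exists x; rewrite oppr_eq0.
Qed.

(** Weyl differencing: the square of the modulus is a sum over pairs of
    words, and the difference of two values of the phase is affine in one of
    them, so the inner sums vanish off phase_null. *)
Lemma phase_sum_sqr :
  `|\sum_(F : {ffun 'I_n -> G}) chi (- Q F)| ^+ 2 <= #|G|%:R ^+ n * #|phase_null|%:R.
Proof.
rewrite -[leLHS](ger0_norm (exprn_ge0 2 (normr_ge0 _))).
rewrite normCK rmorph_sum /= big_distrlr /=.
have -> : \sum_(F : {ffun 'I_n -> G}) \sum_(F' : {ffun 'I_n -> G}) chi (- Q F) * (chi (- Q F'))^* =
    \sum_(Z : {ffun 'I_n -> G}) chi (- Q Z) * \sum_(F : {ffun 'I_n -> G}) chi (- (\sum_i B (F i) (row_comb Z i))).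
  rewrite exchange_big /=.
  under eq_bigr => F _ do rewrite (reindex_inj (addrI F)) /=.
  rewrite exchange_big /=; apply: eq_bigr => Z _; rewrite mulr_sumr.
  apply: eq_bigr => F _; rewrite -(chiN m_gt1 z_prim) -!(chiD m_gt1 z_prim).
  by congr (chi _); rewrite phase_polarization; ring.
have Gn0 : 0 <= #|G|%:R ^+ n :> C by rewrite exprn_ge0.
rewrite mulr_natr -sumr_const.
apply: le_trans (ler_norm_sum _ _ _) _; rewrite [leRHS]big_mkcond /=.
apply: ler_sum => Z _; rewrite normrM (norm_chi m_gt1 z_prim) mul1r.
exact: sum_polarized.
Qed.

Variables (g : nat) (v : 'I_g -> 'I_n -> 'Z_m).
Hypothesis v_gen : forall u : 'I_n -> 'Z_m,
  exists (c : 'I_g -> 'Z_m) (y w : 'I_n -> 'Z_m), (forall i, h%:R * w i = 0) /\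
    forall i, u i = \sum_k c k * v k i + \sum_j D i j * y j + w i.

(** The right radical of the form h B. *)
Definition scaled_radical : {set G} := [set y | [forall x, b (phi x) y *+ h == 0]].

Lemma scaled_radicalP y : reflect (forall x, B x y *+ h = 0) (y \in scaled_radical).
Proof.
by rewrite inE; apply: (iffP forallP) => H x; apply/eqP; exact: H.
Qed.

Let test_values Z : {ffun 'I_g -> {ffun G -> 'Z_m}} :=
  [ffun k => [ffun x => B x (\sum_j Z j *+ v k j) *+ h]].

(** The values of h B (x, .) on the combinations of Z by the generators v,
    on the columns of D (where h D = C kills Z) and on vectors killed by h
    determine its values on every combination, hence on every letter. *)
Lemma phase_null_fiber Z Z' : Z \in phase_null -> Z' \in phase_null ->
  test_values Z = test_values Z' -> forall i, Z i - Z' i \in scaled_radical.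
Proof.
have [BBr BBl] := pull_biadditive.
move=> /phase_nullP Z0 /phase_nullP Z'0 eZ i0.
pose W i := Z i - Z' i.
have W0 i x : \sum_j B x (W j) * Cm i j = 0.
  transitivity (B x (row_comb Z i) - B x (row_comb Z' i)); last first.
    by rewrite Z0 Z'0 subrr.
  rewrite !(zmod_morph_sum _ _ _ (BBr _)) -sumrB; apply: eq_bigr => j _.
  by rewrite !(zmod_morphMn _ (BBr _)) !mulrn_Zm // BBr mulrBl.
have Wv k x : (\sum_j B x (W j) * v k j) *+ h = 0.
  have /ffunP/(_ k)/[!ffunE]/ffunP/(_ x)/[!ffunE] := eZ.
  move/eqP; rewrite -subr_eq0 -mulrnBl -(BBr x) -sumrB => /eqP e.
  rewrite -[RHS]e; congr (_ *+ _); rewrite (zmod_morph_sum _ _ _ (BBr _)).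
  apply: eq_bigr => j _; rewrite -mulrnBl.
  by rewrite (zmod_morphMn _ (BBr _)) mulrn_Zm.
apply/scaled_radicalP => x; rewrite -/(W i0).
have [c [y [w [w0 uE]]]] := v_gen (fun i => (i == i0)%:R).
have -> : B x (W i0) = \sum_i B x (W i) * (i == i0)%:R.
  rewrite (bigD1 i0) //= eqxx mulr1 big1 ?addr0 // => i /negPf ->.
  by rewrite mulr0.
under eq_bigr => i _ do rewrite uE !mulrDr.
rewrite !big_split /= !mulrnDl.
have -> : (\sum_i B x (W i) * w i) *+ h = 0.
  rewrite -sumrMnl big1 // => i _.
  by rewrite -mulr_natl mulrCA w0 mulr0.
have -> : (\sum_i B x (W i) * \sum_k c k * v k i) *+ h = 0.
  under eq_bigr => i _ do rewrite mulr_sumr.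
  rewrite exchange_big -sumrMnl big1 //= => k _.
  under eq_bigr => i _ do rewrite mulrCA.
  by rewrite -mulr_sumr -mulrnAr Wv mulr0.
rewrite add0r addr0; under eq_bigr => i _ do rewrite mulr_sumr.
rewrite exchange_big -sumrMnl big1 //= => j _.
transitivity (\sum_i - (B x (W i) * Cm j i) * y j).
  rewrite -sumrMnl; apply: eq_bigr => i _.
  by rewrite -mulr_natl mulrCA mulrA -mulrN -C_skew CD; ring.
by rewrite -mulr_suml sumrN W0 oppr0 mul0r.
Qed.

(** An element of phase_null is determined, up to letters in the radical, by
    g elements of the quotient of G by the radical, and this quotient has at
    least two elements. *)
Lemma card_phase_null : ~ (forall x, phi x *+ h = 0) ->
  (#|phase_null| * 2 ^ (n - g) <= #|G| ^ n)%N.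
Proof.
have [BBr BBl] := pull_biadditive.
have [[bBr bBl] _ b_nd] := bP.
move=> hp.
have [gn|ng] := leqP g n; last first.
  have -> : (n - g = 0)%N by apply/eqP; rewrite subn_eq0 ltnW.
  by rewrite expn0 muln1 (leq_trans (max_card _)) // card_ffun card_ord.
pose rho y : {ffun G -> 'Z_m} := [ffun x => B x y *+ h].
have rhoS y y' : (rho y == rho y') = (y - y' \in scaled_radical).
  apply/eqP/scaled_radicalP => [e x|e].
    by have /ffunP/(_ x) := e; rewrite !ffunE BBr mulrnBl => ->; rewrite subrr.
  by apply/ffunP => x; rewrite !ffunE; apply/eqP; rewrite -subr_eq0 -mulrnBl -BBr e.
have IR := card_image_kernel rhoS.
set I := #|rho @: _| in IR; set r := #|scaled_radical| in IR.
have r0 : (0 < r)%N.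
  by apply/card_gt0P; exists 0; apply/scaled_radicalP => x;
    rewrite (zmod_morph0 (BBr x)) mul0rn.
have I2 : (2 <= I)%N.
  rewrite leqNgt; apply/negP; rewrite ltnS => I1; apply: hp => x; apply: b_nd => y.
  have : y - 0 \in scaled_radical.
    by rewrite -rhoS; apply/eqP/(card_le1_eqP I1); apply: imset_f; rewrite finset.in_setT.
  rewrite subr0 => /scaled_radicalP/(_ x).
  by rewrite (zmod_morphMn _ (bBl _)).
have : (#|phase_null| <= I ^ g * r ^ n)%N.
  apply: leq_trans (card_fibers_le (f := test_values) (k := (r ^ n)%N) _) _.
    move=> Z' Z'0.
    rewrite -(card_imset _ (@addIr _ (- Z'))) -[X in (_ <= _ ^ X)%N](card_ord n).
    rewrite -card_ffun_on; apply/subset_leq_card/fintype.subsetP.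
    move=> _ /imsetP[Z + ->]; rewrite inE => /andP[Z0 /eqP eZ].
    by apply/ffun_onP => i; rewrite !ffunE; apply: phase_null_fiber.
  rewrite leq_mul2r; apply/orP; right.
  rewrite -[X in (_ <= _ ^ X)%N](card_ord g) -card_ffun_on.
  apply/subset_leq_card/fintype.subsetP => _ /imsetP[Z _ ->].
  by apply/ffun_onP => k; rewrite ffunE; apply: imset_f; rewrite finset.in_setT.
move=> NI; apply: (@leq_trans (I ^ g * r ^ n * I ^ (n - g))).
  by apply: leq_mul => //; case: (n - g)%N => // k; rewrite leq_exp2r.
by rewrite mulnAC -expnD subnKC // -expnMn IR.
Qed.

Lemma phase_average_small : ~ (forall x, phi x *+ h = 0) ->
  `|#|G|%:R ^- n * \sum_(F : {ffun 'I_n -> G}) chi (- Q F)| ^+ 2 <= 2 ^- (n - g).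
Proof.
move=> /card_phase_null cN.
have G0 : 0 < #|G|%:R :> C by rewrite ltr0n; apply/card_gt0P; exists 0.
rewrite normrM exprMn ger0_norm ?invr_ge0 ?exprn_ge0 ?(ltW G0) //.
rewrite -[leRHS]mul1r ler_pdivlMr ?exprn_gt0 //.
rewrite exprVn -mulrA ler_pdivrMl ?exprn_gt0 // mulr1.
apply: le_trans (ler_wpM2r _ phase_sum_sqr) _; first by rewrite exprn_ge0.
rewrite -mulrA expr2 ler_pM2l ?exprn_gt0 // -!natrX -natrM ler_nat //.
Qed.

End PhaseAverage.

(** * Alternating forms and the exterior square *)

Lemma counting_image (K : realType) (T : choiceType) (S : finType) (P : {pred S})
    (f : S -> T) (X : set T) :
  {in P &, injective f} -> (forall s, s \in P -> X (f s)) ->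
  (forall x, X x -> exists2 s, s \in P & f s = x) ->
  counting X = (#|P|%:R)%:E :> \bar K.
Proof.
move=> fI fX Xf; pose Y := seq_fset tt [seq f s | s in P].
have -> : X = [set` Y]%classic.
  apply/seteqP; split=> x /=; rewrite seq_fsetE.
    by move=> /Xf[s sP <-]; apply/mapP; exists s; rewrite ?mem_enum.
  by move=> /mapP[s]; rewrite mem_enum => /fX ? ->.
rewrite /counting asboolT ?set_fsetK; last exact: finite_fset.
rewrite size_seq_fset undup_id ?size_map -?cardE //.
rewrite map_inj_in_uniq ?enum_uniq // => x y; rewrite !mem_enum; exact: fI.
Qed.

Section FiniteCopy.
Variables (Q : zmodType) (S : finType) (r : Q -> S) (s : S -> Q).

(** A group that is a retract of a finite type, with the finite structure that
    the retraction induces; it makes perfect_pairing available for the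
    exterior square, a quotient of an infinite group. *)
Definition fin_copy of cancel r s : Type := Q.
Variable rK : cancel r s.
HB.instance Definition _ := GRing.Zmodule.on (fin_copy rK).
HB.instance Definition _ :=
  PCanIsCountable (can_pcan rK : @pcancel S (fin_copy rK) r _).
HB.instance Definition _ := fintype.isFinite.Build (fin_copy rK)
  (@pcan_enumP (fin_copy rK) S r _ (can_pcan rK)).

End FiniteCopy.

Section AlternatingForms.
Variables (m : nat) (m_gt1 : (1 < m)%N) (A : finZmodType).
Hypothesis mA : forall x : A, x *+ m = 0.

Definition alternating_form (B : {ffun A * A -> 'Z_m}) : bool :=
  [&& [forall x, forall y, forall c, B (x - y, c) == B (x, c) - B (y, c)],
      [forall x, forall y, forall c, B (c, x - y) == B (c, x) - B (c, y)]
    & [forall x, B (x, x) == 0]].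

Lemma alternating_formP (B : {ffun A * A -> 'Z_m}) : reflect
  (biadditive (fun x y => B (x, y)) /\ forall x, B (x, x) = 0) (alternating_form B).
Proof.
apply: (iffP and3P) => [[/forallP Bl /forallP Br /forallP B0]|[[Br Bl] B0]].
  split=> [|x]; last exact/eqP.
  split=> c x y; apply/eqP.
    exact: (forallP (forallP (Br x) y) c).
  exact: (forallP (forallP (Bl x) y) c).
split; do ?[apply/forallP => ?]; apply/eqP; [exact: Bl|exact: Br|exact: B0].
Qed.

Let F := {ffun A * A -> int}.
Definition extsq_pi (u : F) : extsq A := \pi_({quot extsq_relgroup A})%qT u.

Lemma extsq_piB : zmod_morphism extsq_pi.
Proof. exact: (raddfB \pi_({quot extsq_relgroup A})%qT). Qed.

Lemma extsq_piK (x : extsq A) :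
  extsq_pi (generic_quotient.repr (x : {quot extsq_relgroup A})) = x.
Proof. by rewrite /extsq_pi reprK. Qed.

Definition wedge (p : A * A) : extsq A := extsq_pi (fgen p.1 p.2).

Lemma free_decomp (u : F) : u = \sum_p (fgen p.1 p.2) *~ u p.
Proof.
apply/ffunP => q; rewrite sum_ffunE (bigD1 q) //= big1 ?addr0 => [|p pq].
  by rewrite ffunMzE ffunE -surjective_pairing eqxx intz.
by rewrite ffunMzE ffunE -surjective_pairing eq_sym (negPf pq) mul0rz.
Qed.

Lemma extsq_pi_eq0 (u : F) : extsq_rel u -> extsq_pi u = 0.
Proof.
move=> ru; rewrite -(zmod_morph0 extsq_piB).
apply/eqP; rewrite eqmodE /= Quotient.equivE subr0.
by apply/asboolP => N; apply.
Qed.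

Lemma wedge_biadditive : biadditive (fun x y => wedge (x, y)).
Proof.
split=> [x|y]; apply: zmod_morphismP => u v; apply/eqP; rewrite -subr_eq0 opprD addrA.
  have /extsq_pi_eq0 := ExtsqDr x u v.
  by rewrite 2!extsq_piB => /eqP.
have /extsq_pi_eq0 := ExtsqDl u v y.
by rewrite 2!extsq_piB => /eqP.
Qed.

Lemma wedgexx x : wedge (x, x) = 0.
Proof. by apply: extsq_pi_eq0; constructor. Qed.

Lemma wedgeMm (p : A * A) : wedge p *+ m = 0.
Proof.
case: p => x y; have [wr _] := wedge_biadditive.
by rewrite -(zmod_morphMn _ (wr x)) mA (zmod_morph0 (wr x)).
Qed.

Lemma extsq_piMz u k : extsq_pi (u *~ k) = extsq_pi u *~ k.
Proof.
case: k => k; first exact: (zmod_morphMn _ extsq_piB).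
rewrite NegzE !mulrNz (zmod_morphN extsq_piB) -!pmulrn.
by rewrite (zmod_morphMn _ extsq_piB).
Qed.

Lemma extsq_decomp x : exists u : F, x = \sum_p wedge p *~ u p.
Proof.
exists (generic_quotient.repr (x : {quot extsq_relgroup A})).
rewrite -[LHS]extsq_piK [in LHS](free_decomp (generic_quotient.repr _)).
rewrite (zmod_morph_sum _ _ _ extsq_piB).
by apply: eq_bigr => p _; exact: extsq_piMz.
Qed.

Lemma extsq_killed (x : extsq A) : x *+ m = 0.
Proof.
have [u ->] := extsq_decomp x; rewrite -sumrMnl big1 // => p _.
by rewrite pmulrn -mulrzA mulrC mulrzA -pmulrn wedgeMm mul0rz.
Qed.

Definition wedge_sum (c : {ffun A * A -> 'Z_m}) : extsq A := \sum_p wedge p *+ c p.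

(** The exterior square is finite: as m kills it, the coefficients in a
    combination of wedges matter only modulo m. *)
Lemma wedge_sum_surj x : exists c, wedge_sum c = x.
Proof.
have [u ->] := extsq_decomp x; exists [ffun p => (u p)%:~R].
by apply: eq_bigr => p _; rewrite ffunE -(mulrzZ m_gt1 extsq_killed).
Qed.

(** The universal property of the exterior square: the kernel of the
    evaluation on the free group is a subgroup that contains the relations. *)
Lemma form_factors (B : {ffun A * A -> 'Z_m}) : alternating_form B -> exists f : extsq A -> 'Z_m,
  zmod_morphism f /\ forall p, f (wedge p) = B p.
Proof.
move=> /alternating_formP[[Br Bl] B0].
pose ev (u : F) : 'Z_m := \sum_p B p *~ u p.
have evB : zmod_morphism ev.
  move=> u v; rewrite /ev -sumrB; apply: eq_bigr => p _.
  by rewrite !ffunE mulrzBr.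
have ev_gen x y : ev (fgen x y) = B (x, y).
  rewrite /ev (bigD1 (x, y)) //= ffunE eqxx big1 ?addr0 // => p /negPf px.
  by rewrite ffunE px.
pose ker_ev : {pred F} := fun u => ev u == 0.
have kerB : zmod_closed ker_ev.
  split=> [|u v]; rewrite /in_mem /= /ker_ev; first by rewrite (zmod_morph0 evB).
  by move=> /eqP eu /eqP ev0; rewrite evB eu ev0 subrr.
(* The relations lie in the kernel of the evaluation, hence so does the
   subgroup that they generate. *)
pose N : zmodClosed F := HB.pack ker_ev (GRing.isZmodClosed.Build F ker_ev kerB).
have ev_rel (u : F) : u \in extsq_relgroup A -> ev u = 0.
  move=> /asboolP/(_ N) uN; apply/eqP; apply: uN => _ [x y c|x y c|x];
    rewrite /in_mem /= /ker_ev ?evB !ev_gen.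
  - by rewrite (zmod_morphD (Bl c)) addrAC addrK subrr.
  - by rewrite (zmod_morphD (Br x)) addrAC addrK subrr.
  - by rewrite B0.
pose f (x : extsq A) := ev (generic_quotient.repr (x : {quot extsq_relgroup A})).
have f_pi u : f (extsq_pi u) = ev u.
  apply/eqP; rewrite -subr_eq0 -evB; apply/eqP/ev_rel.
  by rewrite Quotient.idealrBE reprK.
exists f; split=> [x y|p]; last by rewrite f_pi ev_gen -surjective_pairing.
by rewrite -[x]extsq_piK -[y]extsq_piK -extsq_piB !f_pi evB.
Qed.

(** Alternating forms are the homomorphisms from the exterior square to Z/m,
    and a perfect pairing on the exterior square represents each of these by
    exactly one element. *)
Lemma counting_extsq (K : realType) :
  counting [set: extsq A] = (#|[pred B | alternating_form B]|%:R)%:E :> \bar K.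
Proof.
have [r rK] := choice wedge_sum_surj.
pose Q : finZmodType := fin_copy rK.
have mQ (x : Q) : x *+ m = 0 by exact: extsq_killed.
have [bQ bQP] := perfect_pairing m_gt1 mQ.
have [[bQr bQl] bQC bQnd] := bQP.
pose Psi (x : Q) : {ffun A * A -> 'Z_m} := [ffun p => bQ x (wedge p)].
have PsiI : injective Psi.
  move=> x x' /ffunP e; apply/eqP; rewrite -subr_eq0; apply/eqP/bQnd => y.
  have [c <-] := wedge_sum_surj y.
  rewrite (zmod_morph_sum _ _ _ (bQr _)) big1 // => p _.
  rewrite (zmod_morphMn _ (bQr _)) bQl.
  by have := e p; rewrite !ffunE => ->; rewrite subrr mul0rn.
have <- : #|codom Psi| = #|[pred B | alternating_form B]|.
  apply: eq_card => B; rewrite [RHS]inE; apply/codomP/idP => [[x ->]|Balt].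
    apply/alternating_formP; have [wr wl] := wedge_biadditive.
    split=> [|y]; last by rewrite ffunE wedgexx (zmod_morph0 (bQr _)).
    by split=> y u v; rewrite !ffunE ?wr ?(wl _ u v) bQr.
  have [f [fB fw]] := form_factors Balt.
  have [x fx] := perfect_represents m_gt1 bQP (f := (f : Q -> 'Z_m)) fB.
  by exists x; apply/ffunP => p; rewrite ffunE -fx fw.
rewrite card_codom //.
apply: (@counting_image K (extsq A) Q predT (fun x => x)) => //.
by move=> x _; exists x.
Qed.

End AlternatingForms.

(** * Alternating endomorphisms killed by h *)

Section TorsionForms.
Variables (m : nat) (m_gt1 : (1 < m)%N) (G : finZmodType).
Hypothesis mG : forall x : G, x *+ m = 0.
Variables (b : G -> G -> 'Z_m) (bP : perfect b) (h : nat).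
Let T : finZmodType := torsion G h.

Lemma torsion_killed (x : T) : x *+ m = 0.
Proof. by apply: val_inj; rewrite raddfMn /= mG. Qed.

(** An isomorphism of G / hG with G[h], obtained by duality: x is sent to the
    element of G[h] that represents the restriction of b x to G[h]. Its kernel
    is the orthogonal of G[h], that is the double orthogonal of hG. *)
Lemma torsion_projection : exists pi : G -> T,
  [/\ zmod_morphism pi, forall t, exists x, pi x = t
    & forall x, pi x = 0 -> exists y, x = y *+ h].
Proof.
have [[br bl] bC b_nd] := bP.
have [bT bTP] := perfect_pairing m_gt1 torsion_killed.
have [[bTr bTl] bTC bT_nd] := bTP.
have /choice[pi piE] : forall x, exists t, forall a : T, b x (val a) = bT t a.
  move=> x; apply: (perfect_represents m_gt1 bTP) => a c.
  by rewrite raddfB br.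
have piB : zmod_morphism pi.
  move=> x y; apply/eqP; rewrite -subr_eq0; apply/eqP/bT_nd => a.
  by rewrite !bTl -!piE bl subrr.
exists pi; split=> // [t|x pix].
  pose S := [set pi x | x in [set: G]].
  have gS : subgr S.
    split; first by apply/imsetP; exists 0; rewrite ?finset.in_setT ?(zmod_morph0 piB).
    move=> _ _ /imsetP[x _ ->] /imsetP[y _ ->].
    by rewrite -piB; apply: imset_f; rewrite finset.in_setT.
  (* The image S of pi has trivial orthogonal, so it is everything. *)
  have : t \in S.
    rewrite -(perpK m_gt1 bTP gS); apply/perpP => a /perpP aS.
    suff -> : a = 0 by rewrite (zmod_morph0 (bTl _)).
    apply: val_inj; apply: b_nd => x; rewrite bC piE; apply: aS.
    by apply: imset_f; rewrite finset.in_setT.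
  by case/imsetP => x _ ->; exists x.
pose hG := [set y *+ h | y in [set: G]].
have ghG : subgr hG.
  split; first by apply/imsetP; exists 0; rewrite ?finset.in_setT ?mul0rn.
  move=> _ _ /imsetP[u _ ->] /imsetP[v _ ->].
  by rewrite -mulrnBl; apply: imset_f; rewrite finset.in_setT.
(* The orthogonal of hG is G[h]. *)
have : x \in hG.
  rewrite -(perpK m_gt1 bP ghG); apply/perpP => a /perpP aP.
  have ah : torsion_pred h a.
    apply/eqP/b_nd => y; rewrite (zmod_morphMn _ (bl y)) -(zmod_morphMn _ (br a)) bC.
    by apply: aP; apply: imset_f; rewrite finset.in_setT.
  by rewrite bC (piE x (Sub a ah : T)) pix (zmod_morph0 (bTl _)).
by case/imsetP => y _ ->; exists y.
Qed.

Definition killed_endo (phi : {ffun G -> G}) : bool :=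
  alternating_endo b phi && [forall x, phi x *+ h == 0].

(** An alternating form on G that is killed by h is one on G / hG, hence one
    on G[h] through torsion_projection. *)
Lemma card_killed_endo :
  #|[pred phi | killed_endo phi]| = #|[pred B : {ffun T * T -> 'Z_m} | alternating_form B]|.
Proof.
have [[br bl] bC b_nd] := bP.
have [pi [piB pi_surj pi_ker]] := torsion_projection.
pose Theta (B : {ffun T * T -> 'Z_m}) : {ffun G -> G} :=
  [ffun x => odflt 0 [pick t | [forall y, b t y == B (pi x, pi y)]]].
have ThetaE B x y : alternating_form B -> b (Theta B x) y = B (pi x, pi y).
  move=> /alternating_formP[[Br Bl] _]; rewrite ffunE; case: pickP => [t|no].
    by move=> /forallP tE; apply/eqP.
  have [|t tE] := @perfect_represents _ m_gt1 _ _ bP (fun y => B (pi x, pi y)).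
    by move=> u v; rewrite piB Br.
  by have /forallP[] := no t; move=> u; rewrite tE.
have b_inj x x' : (forall y, b x y = b x' y) -> x = x'.
  move=> e; apply/eqP; rewrite -subr_eq0; apply/eqP/b_nd => y.
  by rewrite bl e subrr.
have ThetaI : {in [pred B | alternating_form B] &, injective Theta}.
  move=> B B' /[!inE] aB aB' e; apply/ffunP => -[s t].
  have [[x <-] [y <-]] := (pi_surj s, pi_surj t).
  by rewrite -!ThetaE // e.
rewrite -(card_in_imset ThetaI); apply: eq_card => phi; rewrite [LHS]inE.
apply/andP/imsetP => [[altp /forallP hp]|[B /[!inE] aB ->]].
  have [sg sgK] := choice pi_surj.
  pose B : {ffun T * T -> 'Z_m} := [ffun p => b (phi (sg p.1)) (sg p.2)].
  have /alternating_endoP[pB pA] := altp.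
  have b_ker x x' y : pi x = pi x' -> b (phi x) y = b (phi x') y.
    move=> e; have [t xt] : exists t, x - x' = t *+ h.
      by apply: pi_ker; rewrite piB e subrr.
    apply/eqP; rewrite -subr_eq0 -bl -pB xt (zmod_morphMn _ pB).
    by rewrite (eqP (hp t)) (zmod_morph0 (bl _)).
  have BE x y : B (pi x, pi y) = b (phi x) y.
    rewrite ffunE /= (b_ker (sg (pi x)) x) ?sgK //.
    rewrite [LHS](alternating_endo_skew bP _ _ altp).
    rewrite [RHS](alternating_endo_skew bP _ _ altp); congr (- _).
    by apply: b_ker; rewrite sgK.
  have aB : alternating_form B.
    apply/alternating_formP; split=> [|t]; last by rewrite ffunE pA.
    split=> t u v; have [[x <-] [y <-] [w <-]] := And3 (pi_surj t) (pi_surj u) (pi_surj v).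
      by rewrite -piB !BE br.
    by rewrite -piB !BE pB bl.
  exists B; first by rewrite inE.
  by apply/ffunP => x; apply: b_inj => y; rewrite ThetaE // BE.
have /alternating_formP[[Br Bl] B0] := aB.
split.
  apply/alternating_endoP; split=> [x y|x]; last by rewrite ThetaE.
  by apply: b_inj => w; rewrite bl !ThetaE // piB Bl.
apply/forallP => x; apply/eqP/b_nd => y.
rewrite (zmod_morphMn _ (bl y)) ThetaE // -(zmod_morphMn _ (Bl _)).
have -> : pi x *+ h = 0.
  by apply: val_inj; rewrite raddfMn /=; apply/eqP; exact: (valP (pi x)).
by rewrite (zmod_morph0 (Bl _)).
Qed.

End TorsionForms.

(** * Reduction of the base ring modulo the exponent *)

(** A ring morphism onto Z/m with kernel m R and measurable fibers; these
    properties are all that is used about the three kinds of base rings. *)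
Definition is_reduction (R : base_ring) m (red : R -> 'Z_m) : Prop :=
  [/\ zmod_morphism red, forall x y, red (x * y) = red x * red y, red 1 = 1,
      forall x, red x = 0 -> exists y, x = y *+ m
    & forall c, ring_borel R (red @^-1` [set c])%classic].

Section ReductionExists.
Variables (m : nat) (m_gt1 : (1 < m)%N).

Lemma Zm_intr_eq0 (k : int) : (k%:~R == 0 :> 'Z_m) = (m %| k)%Z.
Proof.
case: k => k; first by rewrite -pmulrn Zm_natr_eq0.
by rewrite NegzE mulrNz oppr_eq0 -pmulrn Zm_natr_eq0 // dvdzE abszN.
Qed.

Lemma Zm_intr_mod (k : int) (d : nat) : (m %| d)%N -> ((k %% d)%Z)%:~R = k%:~R :> 'Z_m.
Proof.
move=> md; apply/eqP; rewrite -subr_eq0 -mulrzBr Zm_intr_eq0.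
rewrite {2}(divz_eq k d) opprD addrCA subrr addr0 -mulNr.
by rewrite dvdz_mull // dvdzE.
Qed.

Lemma reductionZ : exists red : BaseZ -> 'Z_m, is_reduction red.
Proof.
exists (fun x : int => x%:~R); split=> //.
- by move=> x y; rewrite mulrzBr.
- by move=> x y; rewrite intrM.
- move=> x /eqP; rewrite Zm_intr_eq0 => /dvdzP[y ->]; exists y.
  by rewrite -mulr_natr natz.
- by move=> c; apply: sub_sigma_algebra.
Qed.

Lemma reductionZmod a (a0 : (0 < a)%N) : (m %| a)%N ->
  exists red : BaseZmod a0 -> 'Z_m, is_reduction red.
Proof.
move=> ma; pose red (x : Zmod a) : 'Z_m :=
  (generic_quotient.repr (x : {quot (zmultiples a)}))%:~R.
have redE k : red (quot_proj (zmultiples a) k) = k%:~R.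
  apply/eqP; rewrite -subr_eq0 -mulrzBr Zm_intr_eq0.
  have : generic_quotient.repr (quot_proj (zmultiples a) k : {quot (zmultiples a)}) - k
      \in zmultiples a.
    by apply/quot_proj_eq; rewrite /quot_proj reprK.
  by apply: dvdz_trans; rewrite dvdzE.
have projB x y : quot_proj (zmultiples a) x - quot_proj (zmultiples a) y =
    quot_proj (zmultiples a) (x - y).
  by rewrite -(zmod_morphismP (@quot_projD _ (zmultiples a))).
exists red; split=> //.
- move=> x y; have [[u ->] [v ->]] := (quot_projW x, quot_projW y).
  by rewrite projB !redE mulrzBr.
- move=> x y; have [[u ->] [v ->]] := (quot_projW x, quot_projW y).
  have -> : quot_proj (zmultiples a) u * quot_proj (zmultiples a) v =
    quot_proj (zmultiples a) (u * v) by rewrite quot_projM.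
  by rewrite !redE intrM.
- exact: (redE 1).
- move=> x; have [u ->] := quot_projW x; rewrite redE => /eqP.
  rewrite Zm_intr_eq0 => /dvdzP[y ->]; exists (quot_proj (zmultiples a) y).
  rewrite -(zmod_morphMn _ (zmod_morphismP (@quot_projD _ (zmultiples a)))).
  by rewrite -mulr_natr natz.
- by move=> c; apply: sub_sigma_algebra.
Qed.

Lemma residueMn p (x : padic_int p) k j :
  residue (x *+ k) j = ((residue x j * k%:Z) %% (p ^ j)%N)%Z.
Proof.
elim: k => [|k IHk]; first by rewrite mulr0n mulr0.
rewrite mulrS {1}/residue /= -/(residue _ _) IHk modzDmr.
by rewrite intS mulrDr mulr1.
Qed.

Lemma residue_addn p (x : padic_int p) j k :
  (residue x (j + k) %% (p ^ j)%N)%Z = residue x j.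
Proof.
elim: k => [|k IHk]; first by rewrite addn0 residue_mod.
rewrite -[RHS]IHk addnS -[residue x (j + k)]residueS; set a := residue x _.
rewrite {1}(divz_eq a (p ^ (j + k))%N) expnD PoszM mulrCA mulrC.
by rewrite modzMDl.
Qed.

(** The k-th residue. If it vanishes, all later residues are divisible by
    p ^ k, and the quotients form again a compatible sequence. *)
Lemma reductionZp p (pp : prime p) k : m = (p ^ k)%N ->
  exists red : BaseZp pp -> 'Z_m, is_reduction red.
Proof.
move=> mpk; have mm j : (k <= j)%N -> (m %| p ^ j)%N by rewrite mpk; apply: dvdn_exp2l.
exists (fun x : padic_int p => (residue x k)%:~R); split=> //.
- apply: zmod_morphismP => x y.
  by rewrite {1}/residue /= -/(residue _ _) -/(residue _ _) Zm_intr_mod ?mm // intrD.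
- move=> x y.
  by rewrite {1}/residue /= -/(residue _ _) -/(residue _ _) Zm_intr_mod ?mm // intrM.
- by rewrite /residue /= Zm_intr_mod ?mm.
- move=> x /eqP; rewrite Zm_intr_eq0 mpk => pkx.
  have x_div j : ((p ^ k)%N %| residue x (j + k))%Z.
    elim: j => [|j IHj]; first by rewrite add0n.
    move: IHj; rewrite -[residue x (j + k)]residueS addSn => IHj.
    rewrite (divz_eq (residue x (j + k).+1) (p ^ (j + k))%N).
    by rewrite rpredD // dvdz_mull // dvdzE /= dvdn_exp2l // leq_addl.
  pose u j := (residue x (j + k) %/ (p ^ k)%N)%Z.
  have pk0 : (p ^ k)%N != 0 :> int by rewrite -lt0n expn_gt0 prime_gt0.
  have uP j : (u j = u j.+1 %[mod (p ^ j)%N])%Z.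
    rewrite /u -[residue x (j + k)]residueS addSn.
    set a := residue x _.
    rewrite {2}(divz_eq a (p ^ (j + k))%N) expnD PoszM mulrA.
    by rewrite divzMDl // modzMDl.
  exists (mk_padic uP); apply: padicP => j; rewrite residueMn /residue /= -/(residue _ _).
  by rewrite modzMml /u divzK // residue_addn.
- move=> c; apply: sub_sigma_algebra => x /= xc; exists k => y xy.
  by rewrite /= xy.
Qed.

End ReductionExists.

Lemma reduction_exists (R : base_ring) (G : finZmodType) m : (1 < m)%N ->
  admissible R G -> exponent [set: G]%SET = m ->
  exists red : R -> 'Z_m, is_reduction red.
Proof.
case: R => [|a a0|p pp] m1 /= adm em.
- exact: reductionZ.
- by apply: reductionZmod => //; rewrite -em.
- have : p.-nat m by rewrite -em pnat_exponent.
  by move=> /p_natP[k mk]; exact: reductionZp mk.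
Qed.

(** * Surjections from a cokernel as generating words *)

Section CokernelSurjections.
Variables (R : base_ring) (m : nat) (m_gt1 : (1 < m)%N).
Variables (red : R -> 'Z_m) (redP : is_reduction red).
Variables (G : finZmodType) (mG : forall x : G, x *+ m = 0).
Variable n : nat.
Implicit Types (F : {ffun 'I_n -> G}) (M : 'M[R]_n).

Lemma red_natr k : red k%:R = k%:R.
Proof. by have [rB _ r1 _ _] := redP; rewrite (zmod_morphMn _ rB) r1. Qed.

Lemma red_surj c : exists x, red x = c.
Proof. by exists (c : nat)%:R; rewrite red_natr natr_Zp. Qed.

(** x differs from the representative of red x by a multiple of m. *)
Lemma morphism_red (f : R -> G) : zmod_morphism f -> forall x, f x = f 1 *+ red x.
Proof.
have [rB _ _ rK _] := redP.
move=> fB x; have [y xy] : exists y, x - (red x : nat)%:R = y *+ m.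
  by apply: rK; rewrite rB red_natr natr_Zp subrr.
rewrite -[LHS]subr0 -(mG (f y)) -(zmod_morphMn _ fB) -xy fB opprB addrC subrK.
by rewrite (zmod_morphMn _ fB).
Qed.

Definition kills_columns F M : bool := [forall j, \sum_i F i *+ red (M i j) == 0].

Definition combine F (v : 'cV[R]_n) : G := \sum_i F i *+ red (v i 0).

Lemma combineB F : zmod_morphism (combine F).
Proof.
have [rB _ _ _ _] := redP; move=> u v; rewrite /combine -sumrB.
by apply: eq_bigr => i _; rewrite !mxE rB (mulrnZB m_gt1 mG).
Qed.

Lemma combine_image F M u : kills_columns F M -> combine F (M *m u) = 0.
Proof.
have [rB rM _ _ _] := redP; move=> /forallP F0.
transitivity (\sum_j (\sum_i F i *+ red (M i j)) *+ red (u j 0)).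
  rewrite /combine; under [RHS]eq_bigr => j _ do rewrite -sumrMnl.
  rewrite exchange_big /=; apply: eq_bigr => i _.
  rewrite mxE (zmod_morph_sum _ _ _ rB).
  have fB : zmod_morphism (fun c : 'Z_m => F i *+ c).
    by move=> c d; rewrite (mulrnZB m_gt1 mG).
  rewrite (zmod_morph_sum _ _ _ fB); apply: eq_bigr => j _.
  by rewrite rM (mulrnZM m_gt1 mG).
by rewrite big1 // => j _; rewrite (eqP (F0 j)) mul0rn.
Qed.

Definition coker_lift M F (x : coker M) : G :=
  combine F (generic_quotient.repr (x : {quot (mximage M)})).

Lemma coker_lift_proj M F v : kills_columns F M ->
  coker_lift F (coker_proj M v) = combine F v.
Proof.
move=> FM; apply/eqP; rewrite -subr_eq0 -combineB.
set w := generic_quotient.repr _.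
have : w - v \in mximage M.
  rewrite Quotient.idealrBE /w; apply/eqP; exact: reprK.
by move=> /asboolP[u ->]; rewrite combine_image.
Qed.

Lemma combine_delta F i : combine F (delta_mx i 0) = F i.
Proof.
have [rB _ r1 _ _] := redP.
rewrite /combine (bigD1 i) //= mxE !eqxx r1 big1 => [|j /negPf ji].
  by rewrite addr0 -[X in _ *+ X]/(nat_of_ord (1%:R : 'Z_m)) mulrn_natr // mulr1n.
by rewrite mxE ji (zmod_morph0 rB).
Qed.

(** A homomorphism from the cokernel is the word of its values on the standard
    basis; it exists when the word kills the columns of M, and it is surjective
    when the word generates. *)
Lemma counting_Sur (K : realType) M :
  counting (@Sur (coker M) G) =
    (#|[pred F | generates m F && kills_columns F M]|%:R)%:E :> \bar K.
Proof.
have [rB _ _ _ _] := redP.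
have projB : zmod_morphism (coker_proj M).
  exact: zmod_morphismP (@coker_projD _ _ M).
apply: (@counting_image K _ _ _ (@coker_lift M)).
- move=> F F' /andP[_ FM] /andP[_ FM'] e; apply/ffunP => i.
  rewrite -!combine_delta -(coker_lift_proj _ FM) e coker_lift_proj //.
- move=> F /andP[/forallP genF FM]; split.
    move=> x y; have [[u ->] [v ->]] := (coker_projW x, coker_projW y).
    by rewrite -projB !coker_lift_proj // combineB.
  move=> y; have /existsP[c /eqP ->] := genF y.
  have [r rc] := choice (fun i => red_surj (c i)).
  exists (coker_proj M (\col_i r i)); rewrite coker_lift_proj //.
  by apply: eq_bigr => i _; rewrite mxE rc.
- move=> f [fB fsurj]; pose F := [ffun i => f (coker_proj M (delta_mx i 0))].
  have fE v : f (coker_proj M v) = combine F v.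
    rewrite {1}[v]matrix_sum_delta.
    rewrite (zmod_morph_sum _ _ _ projB) (zmod_morph_sum _ _ _ fB).
    apply: eq_bigr => i _; rewrite big_ord1 ffunE.
    have gB : zmod_morphism (fun r : R => f (coker_proj M (r *: delta_mx i 0))).
      by move=> r s; rewrite /= scalerBl projB fB.
    by rewrite (morphism_red gB) scale1r.
  have FM : kills_columns F M.
    apply/forallP => j; apply/eqP.
    transitivity (combine F (M *m delta_mx j 0)).
      by apply: eq_bigr => i _; rewrite -colE mxE.
    rewrite -fE; have -> : coker_proj M (M *m delta_mx j 0) = coker_proj M 0.
      apply/eqP; rewrite eqmodE /= Quotient.equivE subr0.
      by apply/asboolP; exists (delta_mx j 0).
    by rewrite (zmod_morph0 projB) (zmod_morph0 fB).
  exists F; last first.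
    apply/funext => x; have [v ->] := coker_projW x.
    by rewrite coker_lift_proj // fE.
  rewrite inE FM andbT; apply/forallP => y; have [x <-] := fsurj y.
  have [v ->] := coker_projW x; apply/existsP; exists [ffun i => red (v i 0)].
  rewrite fE; apply/eqP/eq_bigr => i _.
  by congr (_ *+ _); rewrite ffunE.
Qed.

End CokernelSurjections.

(** * The expectation as a moment *)

Section Expectation.
Local Open Scope classical_set_scope.
Local Open Scope ereal_scope.
Variables (K : realType) (R : base_ring) (m : nat) (m_gt1 : (1 < m)%N).
Variables (red : R -> 'Z_m) (redP : is_reduction red).
Variables (G : finZmodType) (mG : forall x : G, (x *+ m = 0)%R).
Variables (n : nat) (C : 'M[R]_n) (d : measure_display) (Omega : measurableType d).
Variables (P : probability Omega K) (X : Omega -> 'M[R]_n).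
Hypothesis X_meas : forall i j, random_elt (fun w => X w i j).
Hypothesis X_sym : forall w, C_symmetric C (X w).
Hypothesis X_indep : independent P
  [set ij : 'I_n * 'I_n | (ij.1 <= ij.2)%N]%SET (fun ij w => X w ij.1 ij.2).

Definition entry_event i j c : set Omega := [set w | red (X w i j) = c].

(** Below the diagonal the law is a point mass, which makes the product over
    all positions the joint law of the entries on and above the diagonal. *)
Definition entry_law (i j : 'I_n) (c : 'Z_m) : K :=
  if (i <= j)%N then fine (P (entry_event i j c)) else ((c == 0)%R)%:R%R.

Definition upper_entries w : {ffun 'I_n * 'I_n -> 'Z_m} :=
  [ffun p : 'I_n * 'I_n => if (p.1 <= p.2)%N then red (X w p.1 p.2) else 0%R].

Lemma measurable_entry_event i j c : measurable (entry_event i j c).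
Proof. by have [_ _ _ _ rb] := redP; exact: X_meas (rb c). Qed.

Lemma entry_lawE (i j : 'I_n) c : (i <= j)%N ->
  P (entry_event i j c) = (entry_law i j c)%:E.
Proof.
move=> ij; rewrite /entry_law ij fineK //.
by apply: fin_num_measure; exact: measurable_entry_event.
Qed.

Lemma upper_entriesE x : [set w | upper_entries w = x] =
  if [forall p : 'I_n * 'I_n, (p.1 <= p.2)%N || (x p == 0%R)]
  then [set w | forall p : 'I_n * 'I_n, p \in [set ij : 'I_n * 'I_n | (ij.1 <= ij.2)%N]%SET ->
          (red @^-1` [set x p]) (X w p.1 p.2)]
  else set0.
Proof.
apply/seteqP; case: ifPn => [/forallP x0|x0]; split=> w //=.
- by move=> <- p; rewrite inE ffunE => ->.
- move=> wx; apply/ffunP => p; rewrite ffunE; case: ifP => pp.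
    by apply: wx; rewrite inE.
  by have := x0 p; rewrite pp => /eqP.
- move=> wx; move: x0; rewrite negb_forall => /existsP[p]; rewrite -wx ffunE.
  by case: ifP; rewrite ?eqxx ?orbT.
Qed.

Lemma measurable_upper_entries x : measurable [set w | upper_entries w = x].
Proof.
rewrite upper_entriesE; case: ifP => _ //.
rewrite (_ : mkset _ = \bigcap_(p in [set p : 'I_n * 'I_n | (p.1 <= p.2)%N])
    entry_event p.1 p.2 (x p)).
  apply: fin_bigcap_measurable => // p _; exact: measurable_entry_event.
by apply/seteqP; split=> w /= wp p; have := wp p; rewrite inE.
Qed.

Lemma prob_upper_entries x :
  P [set w | upper_entries w = x] = (\prod_p entry_law p.1 p.2 (x p))%:E.
Proof.
have [_ _ _ _ rb] := redP.
rewrite upper_entriesE; case: ifPn => [/forallP x0|].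
  rewrite (X_indep (subxx _) (U := fun p => red @^-1` [set x p])) => [|p _];
    last exact: rb.
  rewrite [X in _ = X%:E](bigID (fun p : 'I_n * 'I_n => (p.1 <= p.2)%N)) /=.
  rewrite [X in (_ * X)%R]big1 => [|p /negPf pp]; last first.
    by have := x0 p; rewrite /entry_law pp /= => ->.
  rewrite mulr1 -prodEFin; apply: eq_big => [p|p]; first by rewrite inE.
  by rewrite inE => pp; rewrite -entry_lawE.
rewrite negb_forall => /existsP[p]; rewrite negb_or => /andP[/negPf pp /negPf xp].
by rewrite measure0 (bigD1 p) //= /entry_law pp xp mul0r.
Qed.

Lemma entry_upper w i j :
  entry (map_mx red C) (upper_entries w) i j = red (X w i j).
Proof.
have [rB _ _ _ _] := redP.
rewrite /entry !ffunE /=; case: (leqP i j) => // ji.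
rewrite (ltnW ji) mxE -rB; congr red.
have := X_sym w; rewrite /C_symmetric => /matrixP/(_ j i); rewrite !mxE => <-.
by rewrite opprB addrC subrK.
Qed.

(** The number of surjections depends only on the entries modulo m on and
    above the diagonal, so the integral is a finite sum over their values. *)
Lemma expectation_moment :
  \int[P]_w counting (@Sur (coker (X w)) G) =
  (moment G (map_mx red C) entry_law)%:E.
Proof.
pose N x : nat := (#|[pred F : {ffun 'I_n -> G} |
  generates m F && kills (map_mx red C) F x]|).
have -> : moment G (map_mx red C) entry_law =
    (\sum_x (N x)%:R * \prod_p entry_law p.1 p.2 (x p))%R.
  rewrite /moment exchange_big /=; apply: eq_bigr => x _.
  rewrite -mulr_sumr mulrC; congr (_ * _)%R.
  rewrite (eq_bigr (fun F => if kills (map_mx red C) F x then 1 else 0)%R);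
    last by move=> F _; case: kills.
  rewrite -big_mkcondr /= sumr_const; congr (_ *+ _)%R.
transitivity (\int[P]_w \sum_(x : {ffun 'I_n * 'I_n -> 'Z_m})
    ((N x)%:R%:E * (\1_[set w | upper_entries w = x] w)%:E)).
  apply: eq_integral => w _; rewrite (counting_Sur m_gt1 redP mG).
  rewrite (bigD1 (upper_entries w)) //= big1 => [|x xw]; last first.
    rewrite indicE memNset ?mule0 //= => e; by rewrite e eqxx in xw.
  rewrite indicE mem_set //= mule1 adde0; congr ((_%:R)%:E).
  apply: eq_card => F; rewrite !inE; congr (_ && _).
  apply: eq_forallb => j; congr (_ == _).
  by apply: eq_bigr => i _; rewrite entry_upper.
rewrite ge0_integral_sum //; last first.
  move=> x; apply: measurable_funeM; apply/measurable_EFinP.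
  exact: measurable_indic (measurable_upper_entries x).
rewrite -sumEFin; apply: eq_bigr => x _.
rewrite ge0_integralZl //; last first.
  by apply/measurable_EFinP; exact: measurable_indic (measurable_upper_entries x).
rewrite integral_indic //; last exact: measurable_upper_entries.
by rewrite setIT EFinM; congr (_ * _); exact: prob_upper_entries.
Qed.

Lemma entry_law_ge0 i j c : (0 <= entry_law i j c)%R.
Proof. by rewrite /entry_law; case: ifP => // _; rewrite fine_ge0. Qed.

Lemma sum_entry_event (i j : 'I_n) (S : pred 'Z_m) : (i <= j)%N ->
  P [set w | S (red (X w i j))] = (\sum_(c | S c) entry_law i j c)%:E.
Proof.
move=> ij; rewrite -sumEFin.
under eq_bigr => c _ do rewrite -(entry_lawE _ ij).
rewrite bigfs ?index_enum_uniq // => [|c _]; last by rewrite mem_index_enum.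
rewrite -measure_fin_bigcup.
- by congr (P _); apply/seteqP; split=> w /= => [Sw|[c /= Sc ->]//];
    exists (red (X w i j)).
- exact: finite_finset.
- by move=> c c' _ _ [w [/= <- <-]].
- by move=> c _; exact: measurable_entry_event.
Qed.

Lemma sum_entry_law i j : (\sum_c entry_law i j c = 1)%R.
Proof.
case: (leqP i j) => ij; last first.
  rewrite (bigD1 0%R) //= big1 => [|c /negPf c0]; last first.
    by rewrite /entry_law leqNgt ij c0.
  by rewrite /entry_law leqNgt ij eqxx addr0.
have := sum_entry_event predT ij.
rewrite (_ : mkset _ = setT) ?probability_setT; last by apply/seteqP.
by move=> [<-].
Qed.

End Expectation.

(** * Fourier coefficients of balanced entries *)

Section BalancedEntries.
Local Open Scope classical_set_scope.
Variables (K : realType) (eps : K) (R : base_ring) (m : nat).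
Variables (red : R -> 'Z_m) (redP : is_reduction red).

(** It reduces the Fourier coefficient at e to the residue field of a
    maximal ideal. *)
Lemma prime_order_multiple (e : 'Z_m) : e != 0 ->
  exists k p, [/\ prime p, e *+ k != 0 & e *+ k *+ p = 0].
Proof.
move=> e0; pose o := #[e]%g.
have oE k : (e *+ k == 0) = (o %| k)%N by rewrite order_dvdn FinRing.zmodXgE.
have o1 : (1 < o)%N.
  rewrite ltn_neqAle order_gt0 andbT eq_sym; apply: contraNneq e0 => o1.
  by rewrite -[e]mulr1n oE o1.
exists (o %/ pdiv o)%N, (pdiv o); split; first exact: pdiv_prime.
  rewrite oE gtnNdvd //; first by rewrite divn_gt0 ?pdiv_gt0 // pdiv_leq // ltnW.
  by rewrite ltn_Pdiv ?prime_gt1 ?pdiv_prime // ltnW.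
by apply/eqP; rewrite -mulrnA oE divnK ?pdiv_dvd.
Qed.

Variables (e : 'Z_m) (p : nat) (p_pr : prime p) (e0 : e != 0) (ep : e *+ p = 0).

Definition annihilated : R -> bool := fun r => e * red r == 0.

Lemma annihilated_zmod : zmod_closed annihilated.
Proof.
have [rB _ _ _ _] := redP; split=> [|x y]; rewrite /in_mem /= /annihilated.
  by rewrite (zmod_morph0 rB) mulr0.
by move=> /eqP ex /eqP ey; rewrite rB mulrBr ex ey subrr.
Qed.

Lemma annihilated_absorbing a : {in annihilated, forall u, a * u \in annihilated}.
Proof.
have [_ rM _ _ _] := redP; move=> u; rewrite /in_mem /= /annihilated.
by move=> /eqP eu; rewrite rM mulrCA eu mulr0.
Qed.

Definition annihilated_ideal : ideal R :=
  HB.pack annihilated (GRing.isZmodClosed.Build R annihilated annihilated_zmod)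
   (isAbsorbing.Build R annihilated annihilated_absorbing).

(** If red x is not killed by e, which has prime order p, then red x acts on
    the multiples of e as an integer prime to p; a Bezout relation inverts x
    modulo the ideal. *)
Lemma annihilated_maximal : maximal_ideal annihilated_ideal.
Proof.
have [rB rM r1 _ _] := redP.
split; first by exists 1; rewrite /in_mem /= /annihilated r1 mulr1.
move=> J IJ; case: (pselect (exists2 x, x \in J & x \notin annihilated_ideal)).
  move=> [x xJ]; rewrite {1}/in_mem /= /annihilated => ex; right.
  pose a : nat := red x.
  have ea : e * red x = e *+ a by rewrite -mulr_natr natr_Zp.
  have pa : ~~ (p %| a)%N.
    apply: contraNN ex => /dvdnP[k ak].
    by rewrite ea ak mulnC mulrnA ep mul0rn.
  have a0 : (0 < a)%N by case: (a) pa; rewrite ?dvdn0.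
  have : coprime a p by rewrite coprime_sym prime_coprime.
  move=> /(coprimeP _ a0)[[u v] /= uv].
  have ux : 1 - x *+ u \in J.
    apply: IJ; rewrite /in_mem /= /annihilated rB r1 (zmod_morphMn _ rB).
    rewrite mulrBr mulr1 mulrnAr ea -mulrnA subr_eq0.
    have -> : (a * u = v * p + 1)%N by lia.
    by rewrite mulrnDr mulnC mulrnA ep mul0rn add0r mulr1n.
  have J1 : 1 \in J by rewrite -(subrK (x *+ u) 1) rpredD // rpredMn.
  by move=> y; rewrite -[y]mulr1 idealMl.
move=> noJ; left=> x; apply/idP/idP => [xJ|]; last exact: IJ.
by apply/negPn/negP => xI; apply: noJ; exists x.
Qed.

Variables (n : nat) (d : measure_display) (Omega : measurableType d).
Variables (P : probability Omega K) (X : Omega -> 'M[R]_n).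
Hypothesis X_meas : forall i j, random_elt (fun w => X w i j).

Lemma balanced_class (i j : 'I_n) c : (i <= j)%N ->
  balanced P eps (fun w => X w i j) ->
  \sum_(c' | e * (c' - c) == 0) entry_law red P X i j c' <= 1 - eps.
Proof.
have [rB _ _ _ _] := redP.
move=> ij /(_ _ annihilated_maximal); have [r rc] := red_surj redP c.
move=> /(_ (quot_proj annihilated_ideal r)).
rewrite (_ : mkset _ = [set w | e * (red (X w i j) - c) == 0]); last first.
  apply/seteqP; split=> w /= => [/(quot_proj_eq annihilated_ideal)|].
    by rewrite /in_mem /= /annihilated rB rc.
  by move=> ew; apply/(quot_proj_eq annihilated_ideal); rewrite /in_mem /= /annihilated rB rc.
by rewrite (sum_entry_event redP P X_meas (fun c' => e * (c' - c) == 0) ij) lee_fin.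
Qed.

End BalancedEntries.

Section CharacterGap.
Variables (K : realType) (m : nat) (m_gt1 : (1 < m)%N).
Variables (z : K[i]) (z_prim : m.-primitive_root z).
Local Notation chi := (chi z).

Lemma Re_chi_lt1 (a : 'Z_m) : a != 0 -> complex.Re (chi a) < 1.
Proof.
rewrite -(chi_eq1 m_gt1 z_prim); have := norm_chi m_gt1 z_prim a.
case: (chi a) => x y; rewrite normc_def => -[] /= xy1 xy.
rewrite ltNge; apply: contra xy => x1.
have {}xy1 : x ^+ 2 + y ^+ 2 = 1.
  have xy0 : 0 <= x ^+ 2 + y ^+ 2 by rewrite addr_ge0 ?sqr_ge0.
  by rewrite -(sqr_sqrtr xy0) xy1 expr1n.
have y0 : y = 0 by nra.
have {}x1 : x = 1 by move: xy1; rewrite y0; nra.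
by rewrite x1 y0.
Qed.

Lemma character_gap : exists2 delta : K, 0 < delta &
  forall a : 'Z_m, a != 0 -> delta <= 1 - complex.Re (chi a).
Proof.
exists (\big[Order.min/1]_(a : 'Z_m | a != 0) (1 - complex.Re (chi a))).
  by apply: lt_bigmin => // a a0; rewrite subr_gt0 Re_chi_lt1.
by move=> a a0; rewrite bigmin_le_cond.
Qed.

Lemma Re_chi_le1 (a : 'Z_m) : complex.Re (chi a) <= 1.
Proof.
by case: (eqVneq a 0) => [->|/Re_chi_lt1/ltW //]; rewrite chi0 /= lexx.
Qed.

Lemma ReZ (x : K) (w : K[i]) : complex.Re (x%:C%C * w) = x * complex.Re w.
Proof. by case: w => a b /=; rewrite mul0r subr0. Qed.

Lemma conj_real_complex (x : K) : (x%:C%C)^* = x%:C%C :> K[i].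
Proof. by apply: conj_Creal; rewrite complex_real. Qed.

Lemma Re_sum (I : Type) (r : seq I) (Q : pred I) (F : I -> K[i]) :
  complex.Re (\sum_(i <- r | Q i) F i) = \sum_(i <- r | Q i) complex.Re (F i).
Proof.
by apply: (big_morph (@complex.Re K)) => // -[a b] [c d].
Qed.

Variables (delta : K) (delta0 : 0 < delta).
Hypothesis chi_gap : forall a : 'Z_m, a != 0 -> delta <= 1 - complex.Re (chi a).

(** The squared modulus is the expectation of chi (e (Y - Y')) for independent
    Y and Y' with law mu. It falls short of 1 by at least delta times the
    probability that e Y and e Y' differ; if they agree, then Y and Y' are in
    the same class for e', which has probability at most 1 - eps given Y'. *)
Lemma hat_gap (mu : 'Z_m -> K) (eps : K) (e e' : 'Z_m) (k : nat) :
  (forall c, 0 <= mu c) -> \sum_c mu c = 1 ->  e' = e *+ k ->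
  (forall c, \sum_(c' | e' * (c' - c) == 0) mu c' <= 1 - eps) ->
  `|\sum_c (mu c)%:C%C * chi (e * c)| ^+ 2 <= (1 - delta * eps)%:C%C.
Proof.
move=> mu0 mu1 e'E mu_eps.
set S := \sum_c _.
have SRe : `|S| ^+ 2 = (complex.Re (`|S| ^+ 2))%:C%C.
  by rewrite RRe_real // ger0_real // exprn_ge0.
rewrite SRe lecR normCK rmorph_sum /= big_distrlr /= Re_sum.
under eq_bigr => c _ do rewrite Re_sum.
have -> : \sum_c \sum_c' complex.Re ((mu c)%:C%C * chi (e * c) *
      ((mu c')%:C%C * chi (e * c'))^*) =
    \sum_c \sum_c' mu c * mu c' * complex.Re (chi (e * (c - c'))).
  apply: eq_bigr => c _; apply: eq_bigr => c' _.
  rewrite rmorphM /= -(chiN m_gt1 z_prim) mulrACA -(chiD m_gt1 z_prim).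
  by rewrite conj_real_complex -rmorphM ReZ mulrBr.
have one : \sum_c \sum_c' mu c * mu c' = 1.
  by under eq_bigr => c _ do rewrite -mulr_sumr mu1 mulr1.
rewrite lerBrDr -lerBrDl.
rewrite -[X in _ <= X - _]one -sumrB.
apply: (@le_trans _ _ (\sum_c mu c * (delta * (1 - \sum_(c' | e' * (c' - c) == 0) mu c')))).
  rewrite -[leLHS]mul1r -{1}mu1 mulr_suml; apply: ler_sum => c _.
  by rewrite ler_wpM2l // ler_wpM2l ?(ltW delta0) // lerBrDr -lerBrDl.
apply: ler_sum => c _; rewrite -sumrB.
rewrite -mu1 [X in X - _](bigID (fun c' => e' * (c' - c) == 0)) /= addrAC subrr add0r.
rewrite mulr_sumr mulr_sumr [leLHS]big_mkcond; apply: ler_sum => c' _.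
rewrite -[X in _ <= X - _]mulr1 -mulrBr.
case: ifPn => [e0|_]; last first.
  by rewrite mulr_ge0 ?mulr_ge0 // subr_ge0 Re_chi_le1.
rewrite [delta * _]mulrC mulrA ler_wpM2l ?mulr_ge0 // chi_gap //.
apply: contraNneq e0; rewrite e'E => ec; by rewrite mulrnAl -opprB mulrN ec oppr0 mul0rn.
Qed.

End CharacterGap.

(** * The clash bound is negligible *)

Section ClashLimit.
Local Open Scope classical_set_scope.
Variable K : realType.

(** Up to the factor 1 - t, the right side is the sum of L.+1 powers of t,
    of which t ^+ L is the smallest. *)
Lemma linear_geometric_le (t : K) L : 0 <= t <= 1 ->
  L.+1%:R * t ^+ L * (1 - t) <= 1 - t ^+ L.+1.
Proof.
move=> /andP[t0 t1]; elim: L => [|L IHL]; first by rewrite expr0 expr1; lra.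
have p0 : 0 <= t ^+ L.+1 <= 1 by rewrite exprn_ge0 ?exprn_ile1.
have := ler_wpM2l t0 IHL; rewrite -[L.+2%:R]/(_%:R) -(natr1 L.+1).
rewrite (exprS t L.+1) (exprS t L) in p0 *; set X := t ^+ L in p0 *.
set l := L.+1%:R; nra.
Qed.

Lemma cvg_linear_geometric (s : K) : 0 <= s < 1 ->
  (fun L => L.+1%:R * s ^+ L) @ \oo --> (0 : K).
Proof.
move=> /andP[s0 s1]; pose t := Num.sqrt s.
have t0 : 0 <= t by exact: sqrtr_ge0.
have st : s = t ^+ 2 by rewrite sqr_sqrtr.
have t1 : t < 1 by rewrite -sqrtr1 ltr_sqrt.
apply: (@squeeze_cvgr _ _ _ _ (fun=> 0) (fun L => (1 - t)^-1 * t ^+ L)).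
- near=> L; rewrite mulr_ge0 ?exprn_ge0 //=.
  rewrite st -exprM mulnC exprM expr2 mulrA ler_wpM2r ?exprn_ge0 //.
  rewrite -[leRHS]mul1r ler_pdivlMr ?subr_gt0 //.
  apply: le_trans (linear_geometric_le L _) _; first by rewrite t0 ltW.
  by rewrite gerBl exprn_ge0.
- exact: cvg_cst.
- rewrite -[X in _ --> X](mulr0 (1 - t)^-1); apply: cvgMr.
  by apply: cvg_expr; rewrite ger0_norm.
Unshelve. all: by end_near. Qed.

Variables (N : nat) (s : K).
Hypotheses (N0 : (0 < N)%N) (s0 : 0 <= s) (s1 : s < 1).

Let r : K := 1 - (2 * N%:R)^-1.

Lemma clash_bound_scaled n L : N%:R ^- n * clash_bound N n s L =
  N%:R ^+ n * s ^+ (L * L.-1) + (2 * N%:R ^+ 2) ^+ (N * N * L) * r ^+ n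
  + ((1 + N%:R * s ^+ L) ^+ n - 1) + s ^+ L.
Proof.
have Nn0 : N%:R != 0 :> K by rewrite pnatr_eq0 -lt0n.
rewrite /clash_bound -exprVn !mulrDr !mulrN !mulrA -!exprMn.
rewrite [N%:R^-1 ^+ n * _]mulrC -[_ * N%:R^-1 ^+ n * _]mulrA -!exprMn.
congr (_ ^+ _ * _ + _ ^+ _ * _ ^+ _ + (_ ^+ _ - _) + _).
- by rewrite expr2 mulrA mulVf // mul1r.
- by rewrite /r; field.
- by rewrite mulrDr mulVf // expr2 !mulrA mulVf // mul1r.
- by rewrite mulVf // expr1n.
- by rewrite mulVf // expr1n mul1r.
Qed.

(** The threshold n / k is linear in n, with k so large that the factor
    (2 N ^ 2) ^ (N ^ 2) per unit of the threshold, which pays for the positions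
    and values of the letters that are not frequent, is beaten by the loss
    r ^ k. Each of the four summands is then bounded by a sequence in n / k that
    tends to 0. *)
Lemma clash_limit : exists2 k, (0 < k)%N &
  N%:R ^- n * clash_bound N n s (n %/ k) @[n --> \oo] --> (0 : K).
Proof.
have N1 : 1 <= N%:R :> K by rewrite ler1n.
have r01 : 0 <= r < 1.
  rewrite subr_ge0 invf_le1 ?gtrBl ?invr_gt0; last by lra.
  by apply/andP; split; lra.
have /andP[r0 r1] := r01.
pose T : K := (2 * N%:R ^+ 2) ^+ (N * N).
have T0 : 0 < T by rewrite exprn_gt0 // mulr_gt0 // exprn_gt0 // ltr0n.
have [k k0 kT] : exists2 k, (0 < k)%N & T * r ^+ k <= 2^-1.
  have : r ^+ k @[k --> \oo] --> 0 by apply: cvg_expr; rewrite ger0_norm.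
  move=> /cvgrPdist_le/(_ (2^-1 / T))[|k _ kP]; first by rewrite divr_gt0.
  exists k.+1 => //; have := kP k.+1 (leqnSn k).
  rewrite /= sub0r normrN ger0_norm ?exprn_ge0 // ler_pdivlMr //.
  by rewrite mulrC.
exists k => //.
have half : `|2^-1| < 1 :> K by rewrite ger0_norm //; lra.
pose B (L : nat) : K := N%:R ^+ (k * 2) * 2^-1 ^+ L.-1 + 2^-1 ^+ L
  + (expR (k%:R * N%:R * (L.+1%:R * s ^+ L)) - 1) + s ^+ L.
have B_cvg : B L @[L --> \oo] --> (0 : K).
  have -> : 0 = N%:R ^+ (k * 2) * 0 + 0 + (expR (k%:R * N%:R * 0) - 1) + 0 :> K.
    by rewrite !mulr0 expR0 subrr !addr0.
  apply: cvgD; last by apply: cvg_expr; rewrite ger0_norm.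
  apply: cvgD; [apply: cvgD|].
  - apply: cvgMr; rewrite -(cvg_shiftS _ _).
    exact: cvg_expr half.
  - exact: cvg_expr half.
  - apply: cvgB; last exact: cvg_cst.
    apply: continuous_cvg; first exact: continuous_expR.
    by apply: cvgMr; apply: cvg_linear_geometric; rewrite s0.
apply: (@squeeze_cvgr _ _ _ _ (fun=> 0) (fun n => B (n %/ k)%N)).
- have : \forall L \near \oo, N%:R ^+ k * s ^+ L <= 2^-1 :> K.
    have : N%:R ^+ k * s ^+ L @[L --> \oo] --> (N%:R ^+ k * 0 : K).
      by apply: cvgMr; apply: cvg_expr; rewrite ger0_norm.
    rewrite mulr0 => /cvgrPdist_le/(_ 2^-1)[|L0 _ L0P]; first by rewrite invr_gt0.
    exists L0 => // L /L0P /=.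
    by rewrite sub0r normrN ger0_norm // mulr_ge0 ?exprn_ge0.
  move=> /(cvg_divnr _ k0) evNk.
  have evL0 := cvg_divnr _ k0 _ (nbhs_infty_gt 0).
  near=> n; have Nk : N%:R ^+ k * s ^+ (n %/ k) <= 2^-1 by near: n; exact: evNk.
  have L0 : (0 < n %/ k)%N by near: n; exact: evL0.
  set L := (n %/ k)%N in Nk L0 *; rewrite clash_bound_scaled.
  have nL : (n <= k * L.+1)%N by rewrite ltnW // mulnC ltn_ceil.
  have Ln : (k * L <= n)%N by rewrite mulnC leq_trunc_div.
  have sL : 0 <= s ^+ L <= 1 by rewrite exprn_ge0 ?exprn_ile1 // ltW.
  have /andP[sL0 sL1] := sL.
  have q1 : 1 <= 1 + N%:R * s ^+ L by rewrite lerDl mulr_ge0.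
  apply/andP; split.
    apply: addr_ge0 => //; apply: addr_ge0; last by rewrite subr_ge0 exprn_ege1.
    by rewrite addr_ge0 ?mulr_ge0 ?exprn_ge0 // mulr_ge0 ?exprn_ge0.
  rewrite /B; apply: lerD => //; apply: lerD; [apply: lerD|].
  + apply: (@le_trans _ _ (N%:R ^+ (k * L.+1) * s ^+ (L * L.-1))).
      by rewrite ler_wpM2r ?exprn_ge0 // ler_weXn2l.
    have -> : (k * L.+1 = k * 2 + k * L.-1)%N by rewrite -mulnDr -{1}(prednK L0).
    rewrite exprD -mulrA ler_wpM2l ?exprn_ge0 // exprM (exprM s) -exprMn.
    by apply: ler_exp => //; rewrite mulr_ge0 ?exprn_ge0.
  + apply: (@le_trans _ _ ((T * r ^+ k) ^+ L)).
      rewrite [leRHS]exprMn /T -!exprM ler_wpM2l ?exprn_ge0 ?mulr_ge0 ?exprn_ge0 //.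
      by rewrite ler_wiXn2l // ltW.
    by apply: ler_exp => //; rewrite mulr_ge0 ?exprn_ge0 // ltW.
  + rewrite lerD2r; apply: (@le_trans _ _ (expR (N%:R * s ^+ L) ^+ n)).
      apply: ler_exp; last exact: expR_ge1Dx.
      by apply: le_trans q1.
    rewrite -expRM_natl ler_expR.
    have : (n%:R : K) <= k%:R * L.+1%:R by rewrite -natrM ler_nat.
    move=> /(ler_wpM2r (mulr_ge0 (ler0n K N) sL0)) /le_trans; apply.
    by rewrite le_eqVlt; apply/orP; left; apply/eqP; ring.
- exact: cvg_cst.
- exact: (@cvg_comp _ _ _ _ B _ _ _ (cvg_divnr _ k0) B_cvg).
Unshelve. all: by end_near. Qed.

End ClashLimit.

(** * Generators of the cokernel of C/h, modulo m *)

Section GenerationTransfer.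
Variables (R : base_ring) (m : nat) (red : R -> 'Z_m) (redP : is_reduction red).
Variables (h n g : nat) (C D : 'M[R]_n).
Hypothesis CD : forall i j, C i j = h%:R * D i j.

(** Every vector is a combination of lifts of the generators plus an element
    of the image of D, up to a vector killed by h; applying red to this relation
    gives one modulo m. *)
Lemma generated_reduction : generated_by (coker (mxdivn h C)) g ->
  exists v : 'I_g -> 'I_n -> 'Z_m, forall u : 'I_n -> 'Z_m,
  exists (c : 'I_g -> 'Z_m) (y w : 'I_n -> 'Z_m), (forall i, h%:R * w i = 0) /\
    forall i, u i = \sum_k c k * v k i + \sum_j map_mx red D i j * y j + w i.
Proof.
have [rB rM r1 _ _] := redP.
pose pi := quot_proj (ann R h).
have piB : zmod_morphism pi by exact: zmod_morphismP (@quot_projD _ (ann R h)).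
have piM x y : pi (x * y) = pi x * pi y by exact: quot_projM.
have <- : map_mx pi D = mxdivn h C.
  apply/mxdivnP => [i j|]; first by exists (D i j); exact: CD.
  by apply/matrixP => i j; rewrite !mxE mulh_proj -CD.
move=> [x xgen].
have /choice[vv vvE] := fun k => coker_projW (x k).
have /choice[rr rrE] : forall ki : 'I_g * 'I_n, exists r, vv ki.1 ki.2 0 = pi r.
  by move=> ki; exact: quot_projW.
exists (fun k i => red (rr (k, i))) => u.
have /choice[U UE] := fun i => red_surj redP (u i).
have [c cE] := xgen (coker_proj (map_mx pi D) (\col_i pi (U i))).
set proj := coker_proj (map_mx pi D) in cE vvE.
have projB : zmod_morphism proj by exact: zmod_morphismP (@coker_projD _ _ _).
have : proj (\col_i pi (U i) - \sum_k pi (c k) *: vv k) = proj 0.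
  rewrite projB (zmod_morph_sum _ _ _ projB) (zmod_morph0 projB) cE.
  apply/eqP; rewrite subr_eq0; apply/eqP/eq_bigr => k _.
  by rewrite vvE; exact/esym/coker_projZ.
move=> /eqP; rewrite eqmodE /= Quotient.equivE subr0 => /asboolP[y' y'E].
have /choice[Y YE] : forall j, exists r, y' j 0 = pi r by move=> j; exact: quot_projW.
pose W i := U i - \sum_k c k * rr (k, i) - \sum_j D i j * Y j.
have hW i : h%:R * W i = 0.
  suff : W i \in ann R h by rewrite /in_mem /= /ann_pred => /eqP.
  rewrite -[W i]subr0; apply/(quot_proj_eq (ann R h)).
  rewrite -/(pi _) -/(pi _) (zmod_morph0 piB) /W !piB !(zmod_morph_sum _ _ _ piB).
  have /matrixP/(_ i 0) := y'E; rewrite !mxE summxE => e.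
  apply/eqP; rewrite subr_eq0; apply/eqP.
  transitivity (pi (U i) - \sum_k (pi (c k) *: vv k) i 0).
    congr (_ - _); apply: eq_bigr => k _.
    by rewrite mxE piM (rrE (k, i)).
  by rewrite e; apply: eq_bigr => j _; rewrite mxE piM YE.
exists (red \o c), (red \o Y), (red \o W); split=> [i|i] /=.
  by rewrite -[h%:R](red_natr redP) -rM hW (zmod_morph0 rB).
rewrite /W !rB !(zmod_morph_sum _ _ _ rB) UE.
under [\sum_k red (c k * _)]eq_bigr => k _ do rewrite rM.
under [\sum_j red (D i j * _)]eq_bigr => j _ do rewrite rM.
under [\sum_j map_mx _ _ _ _ * _]eq_bigr => j _ do rewrite mxE.
by ring.
Qed.

End GenerationTransfer.

(** * The error term for a fixed size *)

Lemma norm_real_complex (K : realType) (x : K) : `|x%:C%C| = (`|x|)%:C%C :> K[i].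
Proof. by rewrite normc_def /= expr0n /= addr0 sqrtr_sqr. Qed.

Section MomentError.
Variables (K : realType) (m : nat) (m_gt1 : (1 < m)%N).
Variables (z : K[i]) (z_prim : m.-primitive_root z).
Variables (G : finZmodType) (b : G -> G -> 'Z_m) (bP : perfect b).
Variables (n h g : nat) (Cm D : 'M['Z_m]_n) (v : 'I_g -> 'I_n -> 'Z_m).
Hypothesis CD : forall i j, Cm i j = h%:R * D i j.
Hypothesis C_skew : forall i j, Cm j i = - Cm i j.
Hypothesis C_diag : forall i, Cm i i = 0.
Hypothesis v_gen : forall u : 'I_n -> 'Z_m,
  exists (c : 'I_g -> 'Z_m) (y w : 'I_n -> 'Z_m), (forall i, h%:R * w i = 0) /\
    forall i, u i = \sum_k c k * v k i + \sum_j D i j * y j + w i.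

(** An alternating phi contributes exactly 1 if h phi = 0, and a negligible
    average of its phase otherwise. *)
Lemma alternating_main_limit :
  `|alternating_main z b Cm - #|[pred phi | killed_endo b h phi]|%:R| <=
    (#|alternating_endo b|%:R * Num.sqrt 2^-1 ^+ (n - g))%:C%C.
Proof.
have N0 : 0 < #|G|%:R :> K[i] by rewrite ltr0n; apply/card_gt0P; exists 0.
pose killed (phi : {ffun G -> G}) := [forall x, phi x *+ h == 0].
rewrite /alternating_main (bigID killed) /=.
have -> : \sum_(phi | alternating_endo b phi && killed phi) #|G|%:R ^- n *
      (\sum_(F : {ffun 'I_n -> G}) chi z (- phase b Cm F (apply_word phi F)))
    = #|[pred phi | killed_endo b h phi]|%:R.
  rewrite (eq_bigr (fun=> 1)) => [|phi /andP[_ /forallP hp]]; last first.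
    rewrite (eq_bigr (fun=> 1)) => [|F _]; last first.
      rewrite (phase_killed bP CD) ?oppr0 ?chi0 // => x; exact/eqP.
    by rewrite sumr_const card_ffun card_ord natrX mulVf // expf_neq0 // gt_eqF.
  by rewrite sumr_const.
rewrite addrAC subrr add0r; apply: le_trans (ler_norm_sum _ _ _) _.
have t0 : 0 <= Num.sqrt (2^-1 : K) by exact: sqrtr_ge0.
apply: (@le_trans _ _ (\sum_(phi | alternating_endo b phi)
    (Num.sqrt (2^-1 : K) ^+ (n - g))%:C%C)).
  rewrite [leLHS]big_mkcondr /=; apply: ler_sum => phi altp.
  case: ifPn => [kp|_]; last by rewrite ler0c exprn_ge0.
  rewrite -(@ler_pXn2r _ 2) ?nnegrE ?normr_ge0 ?ler0c ?exprn_ge0 //.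
  apply: le_trans (phase_average_small m_gt1 z_prim bP CD C_skew C_diag altp v_gen _) _.
    by move=> hp; case/negP: kp; apply/forallP => x; apply/eqP.
  have sq2 : (Num.sqrt (2^-1 : K) ^+ (n - g)) ^+ 2 = 2^-1 ^+ (n - g).
    by rewrite -exprM mulnC exprM sqr_sqrtr ?invr_ge0.
  by rewrite -(rmorphXn (real_complex K)) sq2 rmorphXn fmorphV rmorph_nat exprVn.
by rewrite sumr_const rmorphM rmorph_nat mulr_natl.
Qed.

Variables (mu : 'I_n -> 'I_n -> 'Z_m -> K) (s : K).
Hypothesis mu1 : forall i j, \sum_c mu i j c = 1.
Hypotheses (s0 : 0 <= s) (s1 : s <= 1).
Hypothesis mu_s : forall (i j : 'I_n) (e : 'Z_m), (i <= j)%N -> e != 0 ->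
  `|\sum_c (mu i j c)%:C%C * chi z (e * c)| <= (s ^+ 2)%:C%C.
Let N := #|G|.

Lemma moment_complex :
  moment G Cm (fun i j c => (mu i j c)%:C%C) = (moment G Cm mu)%:C%C.
Proof.
rewrite /moment rmorph_sum; apply: eq_bigr => F _.
rewrite rmorph_sum; apply: eq_bigr => x _.
by rewrite rmorphM rmorph_prod rmorph_nat.
Qed.

Lemma moment_error L :
  `|moment G Cm mu - #|[pred phi | killed_endo b h phi]|%:R| <=
    (2 ^ (N * N))%:R * (N%:R ^- n * clash_bound N n s L)
    + #|alternating_endo b|%:R * N%:R * (N.-1%:R / N%:R) ^+ n
    + #|alternating_endo b|%:R * Num.sqrt 2^-1 ^+ (n - g).
Proof.
rewrite -lecR -norm_real_complex rmorphB /= -moment_complex rmorph_nat.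
rewrite -(subrKA (alternating_main z b Cm)).
apply: le_trans (ler_normD _ _) _; rewrite [leRHS]rmorphD /=.
apply: lerD; last exact: alternating_main_limit.
have mu1C i j : \sum_c (mu i j c)%:C%C = 1 :> K[i] by rewrite -rmorph_sum mu1.
have mu_sC (i j : 'I_n) (e : 'Z_m) : (i <= j)%N -> e != 0 ->
    `|mu_hat z (fun i j c => (mu i j c)%:C%C) i j e| <= s%:C%C ^+ 2.
  by move=> ij e0; rewrite -rmorphXn; exact: mu_s.
have sC0 : 0 <= s%:C%C by rewrite ler0c.
have sC1 : s%:C%C <= 1 by rewrite -[1]/(1%:C%C) lecR.
apply: le_trans (moment_main_bound m_gt1 z_prim bP Cm mu1C sC0 sC1 mu_sC) _.
rewrite rmorphD /=; apply: lerD.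
  have -> : \sum_(w : {ffun 'I_n -> G * G} |
        ~~ isotropic_word (hyp_form b) (hyp_quad b) w)
        s%:C%C ^+ clashes (hyp_form b) (hyp_quad b) w =
      (\sum_(w : {ffun 'I_n -> G * G} |
        ~~ isotropic_word (hyp_form b) (hyp_quad b) w)
        s ^+ clashes (hyp_form b) (hyp_quad b) w)%:C%C.
    by rewrite rmorph_sum; apply: eq_bigr => w _; rewrite rmorphXn.
  rewrite -(rmorph_nat (real_complex K)) -rmorphXn -fmorphV -rmorphM lecR.
  rewrite mulrCA ler_wpM2l ?invr_ge0 ?exprn_ge0 //.
  by apply: (clash_estimate m_gt1 (hyp_formP bP)) => //; rewrite card_prod.
rewrite -!(rmorph_nat (real_complex K)) -rmorphM -rmorphXn -fmorphV -rmorphM lecR.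
by rewrite natrM natrX expr_div_n !mulrA.
Qed.

End MomentError.

(** * The limit *)

Section TrivialGroup.
Variables (K : realType) (G : finZmodType) (G_trivial : forall x : G, x = 0).

Lemma counting_Sur_trivial (A : zmodType) : counting (@Sur A G) = 1%:E :> \bar K.
Proof.
rewrite (@counting_image K _ unit predT (fun=> fun=> 0)) ?cardE ?enumT ?unlock //.
- by move=> [] [].
- move=> _ _; split; first by move=> x y; rewrite subr0.
  by move=> y; exists 0; rewrite (G_trivial y).
- by move=> f _; exists tt => //; apply/funext => x; rewrite [RHS]G_trivial.
Qed.

Lemma counting_extsq_trivial h : counting [set: extsq (torsion G h)] = 1%:E :> \bar K.
Proof.
rewrite (@counting_image K _ unit predT (fun=> 0)) ?cardE ?enumT ?unlock //.
  by move=> [] [].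
move=> x _; exists tt => //; have [u ->] := extsq_decomp x.
rewrite big1 // => -[s t] _; have [wr _] := wedge_biadditive (torsion G h).
have -> : t = 0 by apply: val_inj; exact: G_trivial.
by rewrite (zmod_morph0 (wr s)) mul0rz.
Qed.

End TrivialGroup.

Lemma cvg_truncated_difference (K : realType) (g : nat -> nat) :
  ((n%:R - (g n)%:R : K) @[n --> \oo] --> +oo)%classic ->
  ((n - g n)%N @[n --> \oo] --> \oo)%classic.
Proof.
move=> /cvgryPge ng; apply/cvgnyPge => A; have := ng A%:R.
apply: filterS => n; rewrite lerBrDr -natrD ler_nat => Agn.
by rewrite leq_subRL // (leq_trans _ Agn) ?leq_addl // addnC.
Qed.

Local Open Scope classical_set_scope.
Local Open Scope ring_scope.

Theorem theorem1p3
    (K : realType) (eps : K) (heps : 0 < eps)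
    (R : base_ring)
    (C : forall n : nat, 'M[R]_n)
    (hC : forall n, alternating_mx (C n))
    (h : nat) (h_gt0 : (0 < h)%N)
    (h_dvd : forall n i j, exists r : R, C n i j = h%:R * r)
    (g : nat -> nat)
    (hg : forall n, generated_by (coker (mxdivn h (C n))) (g n))
    (d : nat -> measure_display)
    (Omega : forall n, measurableType (d n))
    (P : forall n, probability (Omega n) K)
    (X : forall n, Omega n -> 'M[R]_n)
    (hX_meas : forall n i j, random_elt (fun w => X n w i j))
    (hX_sym : forall n w, C_symmetric (C n) (X n w))
    (hX_indep : forall n, independent (P n)
       [set ij : 'I_n * 'I_n | (ij.1 <= ij.2)%N]%SET
       (fun ij w => X n w ij.1 ij.2))
    (hX_bal : forall n (i j : 'I_n), (i <= j)%N ->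
       balanced (P n) eps (fun w => X n w i j))
    (hng : ((n%:R - (g n)%:R : K) @[n --> \oo]) --> +oo)
    (G : finZmodType) (hG : admissible R G) :
  (\int[P n]_w counting (@Sur (coker (X n w)) G))%E @[n --> \oo]
    --> (counting [set: extsq (torsion G h)] : \bar K).
Proof.
pose m := exponent [set: G]%SET.
have mG (x : G) : x *+ m = 0.
  by rewrite -FinRing.zmodXgE expg_exponent // finset.in_setT.
(* 'Z_1 is the ring with two elements, so exponent 1 is treated apart. *)
have [m1|m_gt1] := leqP m 1.
  have G_trivial (x : G) : x = 0.
    by have := mG x; have -> : m = 1%N by apply/eqP; rewrite eqn_leq m1 exponent_gt0.
  rewrite counting_extsq_trivial //.
  have E1 n : (\int[P n]_w counting (@Sur (coker (X n w)) G) = 1%:E)%E.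
    under eq_integral => w _ do rewrite counting_Sur_trivial //.
    by rewrite integral_cst // mul1e; exact: probability_setT.
  under eq_fun => n do rewrite E1.
  exact: cvg_cst.
have [red redP] := reduction_exists m_gt1 hG erefl.
have [rB rM r1 _ _] := redP.
have [b bP] := perfect_pairing m_gt1 mG.
have [z z_prim] := prim_root_exists K[i] (ltnW m_gt1).
have [delta delta0 chi_gap] := character_gap m_gt1 z_prim.
(* Fourier coefficients are at most s2 = s ^+ 2 in modulus. *)
pose s2 : K := Num.sqrt (1 - delta * eps); pose s := Num.sqrt s2.
have de0 : 0 < delta * eps by rewrite mulr_gt0.
have s0 : 0 <= s by exact: sqrtr_ge0.
have s21 : s2 < 1 by rewrite -sqrtr1 ltr_sqrt // ltrBlDr ltrDl.
have s1 : s < 1 by rewrite -sqrtr1 ltr_sqrt.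
have N0 : (0 < #|G|)%N by apply/card_gt0P; exists 0.
pose mu n := entry_law red (P n) (X n).
pose M n : K := moment G (map_mx red (C n)) (mu n).
pose c := #|[pred phi | killed_endo b h phi]|.
have hat_small n (i j : 'I_n) (e : 'Z_m) : (i <= j)%N -> e != 0 ->
    `|\sum_c (mu n i j c)%:C%C * chi z (e * c)| <= (s ^+ 2)%:C%C.
  move=> ij e0; have [k [p [p_pr ek0 ekp]]] := prime_order_multiple e0.
  have := hat_gap m_gt1 z_prim delta0 chi_gap (entry_law_ge0 _ _ _ i j)
    (sum_entry_law redP (P n) (hX_meas n) i j) erefl
    (fun c => balanced_class redP p_pr ek0 ekp (hX_meas n) c ij (hX_bal n i j ij)).
  set S := \sum_c _ => S2.
  have de1 : 0 <= 1 - delta * eps.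
    by rewrite -ler0c; apply: le_trans S2; rewrite exprn_ge0.
  have s22 : s2 ^+ 2 = 1 - delta * eps by rewrite sqr_sqrtr.
  rewrite sqr_sqrtr ?sqrtr_ge0 // -(@ler_pXn2r _ 2) ?nnegrE ?normr_ge0 //.
    have <- : (s2 ^+ 2)%:C%C = s2%:C%C ^+ 2 by exact: rmorphXn.
    by rewrite s22.
  by rewrite ler0c sqrtr_ge0.
have [k k0 clash0] := clash_limit N0 s0 s1.
pose E n : K := (2 ^ (#|G| * #|G|))%:R *
      (#|G|%:R ^- n * clash_bound #|G| n s (n %/ k))
    + #|alternating_endo b|%:R * #|G|%:R * (#|G|.-1%:R / #|G|%:R) ^+ n
    + #|alternating_endo b|%:R * Num.sqrt 2^-1 ^+ (n - g n).
have ME n : `|M n - c%:R| <= E n.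
  have /choice[Df DfE] : forall ij : 'I_n * 'I_n, exists r, C n ij.1 ij.2 = h%:R * r.
    by move=> ij; exact: h_dvd.
  pose D : 'M[R]_n := \matrix_(i, j) Df (i, j).
  have CD i j : C n i j = h%:R * D i j by rewrite mxE (DfE (i, j)).
  have [v v_gen] := generated_reduction redP CD (hg n).
  have [CT C0] := hC n.
  apply: (@moment_error K m m_gt1 z z_prim G b bP n h (g n) (map_mx red (C n))
    (map_mx red D) v) => //.
  - by move=> i j; rewrite mxE [in RHS]mxE CD rM (red_natr redP).
  - move=> i j; rewrite !mxE -(zmod_morphN rB); congr red.
    by have /matrixP/(_ i j) := CT; rewrite !mxE.
  - by move=> i; rewrite mxE C0 (zmod_morph0 rB).
  - exact: (sum_entry_law redP (P n) (hX_meas n)).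
  - exact: ltW.
  - exact: hat_small.
have E0 : E n @[n --> \oo] --> (0 : K).
  have -> : 0 = (2 ^ (#|G| * #|G|))%:R * 0 + #|alternating_endo b|%:R * #|G|%:R * 0
      + #|alternating_endo b|%:R * 0 :> K by rewrite !mulr0 !addr0.
  apply: cvgD; [apply: cvgD|]; apply: cvgMr.
  - exact: clash0.
  - apply: cvg_expr; rewrite ger0_norm ?divr_ge0 //.
    by rewrite ltr_pdivrMr ?ltr0n // mul1r ltr_nat prednK.
  - apply: (@cvg_comp _ _ _ (fun n => n - g n)%N (fun k => Num.sqrt 2^-1 ^+ k) _ _ _
      (cvg_truncated_difference hng)).
    apply: cvg_expr; rewrite ger0_norm ?sqrtr_ge0 // -[ltRHS]sqrtr1 ltr_sqrt //.
    by lra.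
have Mc : M n @[n --> \oo] --> (c%:R : K).
  apply: (@squeeze_cvgr _ _ _ _ (fun n => c%:R - E n) (fun n => c%:R + E n)).
  - by apply: nearW => n; rewrite -ler_distl ME.
  - by rewrite -[X in _ --> X]subr0; apply: cvgB => //; exact: cvg_cst.
  - by rewrite -[X in _ --> X]addr0; apply: cvgD => //; exact: cvg_cst.
have -> : counting [set: extsq (torsion G h)] = (c%:R)%:E :> \bar K.
  by rewrite (counting_extsq m_gt1 (torsion_killed mG (h := h))) -(card_killed_endo m_gt1 mG bP).
under eq_fun => n do
  rewrite (expectation_moment m_gt1 redP mG (hX_meas n) (hX_sym n) (hX_indep n)).
apply: cvg_EFin; first exact: nearW.
exact: Mc.
Qed.
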